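(* Let $(X,d,\mu)$ be a doubling metric measure space, and let $p\ge1$, $\alpha>0$. Assume that there exists $R>0$ such that $\inf_{x\in X}\mu(B(x,R))>0$, and that the property $\mathcal P(p,\alpha)$ holds. Let $q=\frac{pQ}{Q-\alpha p}$ with the convention that $q=\infty$ if $Q=\alpha p$. Let $r,s\in(0,+\infty]$ and $\theta\in(0,1]$ satisfy $$\frac1r=\frac\theta q+\frac{1-\theta}s.$$ If $Q=\alpha p$ with $p>1$, assume moreover $r<+\infty$. Then there exists a constant $C>0$ such that for every $f\in KS^{\alpha,p}(X)$, $$\|f\|_{L^r(X,\mu)}\le C\left(\|f\|_{L^p(X,\mu)}+\mathrm{Var}_p(f)\right)^\theta\|f\|_{L^s(X,\mu)}^{1-\theta}.$$
   Context: Setting: $(X,d)$ is a metric space with more than one point, $\mu$ is a Borel regular measure which is positive and doubling: there is $C>0$ with $0<\mu(B(x,2r))\le C\mu(B(x,r))<+\infty$ for all $x\in X$, $r>0$, where $B(x,r)=\{y:d(x,y)<r\}$. $Q\in(0,\infty)$ denotes a fixed constant for which there is $C>0$ such that $\frac{\mu(B(x,R))}{\mu(B(x,r))}\le C\left(\frac Rr\right)^Q$ for all $0<r\le R$, $x\in X$ (it exists by doubling). For $p\ge1$, $\alpha\ge0$, $r>0$, $f\in L^p(X,\mu)$ put $$E_{p,\alpha}(f,r)=\int_X\frac{1}{\mu(B(x,r))}\int_{B(x,r)}\frac{|f(y)-f(x)|^p}{r^{p\alpha}}\,d\mu(y)\,d\mu(x).$$ $\mathcal B^{\alpha,p}(X)=\{f\in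 L^p(X,\mu):\sup_{r>0}E_{p,\alpha}(f,r)<+\infty\}$, $KS^{\alpha,p}(X)=\{f\in L^p(X,\mu):\limsup_{r\to0}E_{p,\alpha}(f,r)<+\infty\}$. ''Constant'' means constant $\mu$-a.e. $\alpha_p=\sup\{\alpha\ge0:\mathcal B^{\alpha,p}(X)\text{ contains non-constant functions}\}$. Property $\mathcal P(p,\alpha)$: $KS^{\alpha,p}(X)$ contains non-constant functions and there is a constant $C\ge1$ such that for every $f\in KS^{\alpha,p}(X)$, $\sup_{r>0}E_{p,\alpha}(f,r)\le C\liminf_{r\to0}E_{p,\alpha}(f,r)$. (If $\mathcal P(p,\alpha)$ holds, then $\alpha=\alpha_p$.) $\mathrm{Var}_p(f)=\liminf_{r\to0}E_{p,\alpha_p}(f,r)^{1/p}$. *)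

(* Defs.v *)
From HB Require Import structures.
From mathcomp Require Import all_boot all_order all_algebra.
From mathcomp Require Import all_classical all_reals all_analysis.

Set Implicit Arguments.
Unset Strict Implicit.
Unset Printing Implicit Defensive.

Import Order.TTheory GRing.Theory Num.Theory.
Import numFieldNormedType.Exports.

Local Open Scope classical_set_scope.
Local Open Scope ring_scope.

(* Measurable types are pointed in the library, so the metric space comes with
   an (arbitrary) base point, which plays no other role. *)
#[short(type="pmetricType")]
HB.structure Definition PointedMetric (K : numDomainType) :=
  { X of Metric K X & isPointed X }.

Notation borel_type X := (g_sigma_algebraType (@open X)).

Section KorevaarSchoen.
Context {R : realType} {X : pmetricType R}.
Variable mu : {measure set (borel_type X) -> \bar R}.
Implicit Types (p a Q : R) (f : borel_type X -> R).

Local Open Scope ereal_scope.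

(* mu_ext mu is the outer measure on all subsets of X induced by mu. *)
Definition borel_regular : Prop :=
  forall A : set (borel_type X), exists B : set (borel_type X),
    [/\ measurable B, A `<=` B & mu B = mu_ext mu A].

Definition positive_doubling : Prop :=
  exists2 C : R, (0 < C)%R & forall (x : X) (r : R), (0 < r)%R ->
    [/\ 0 < mu (ball x (2 * r)%R),
        mu (ball x (2 * r)%R) <= C%:E * mu (ball x r) &
        C%:E * mu (ball x r) < +oo].

Definition volume_growth Q : Prop :=
  exists2 C : R, (0 < C)%R & forall (x : X) (r s : R), (0 < r)%R -> (r <= s)%R ->
    mu (ball x s) / mu (ball x r) <= (C * (s / r) `^ Q)%:E.

Definition KS_energy p a f (r : R) : \bar R :=
  \int[mu]_x ((mu (ball (x : X) r))^-1 *
    \int[mu]_(y in ball (x : X) r) (`|f y - f x| `^ p / r `^ (p * a))%:E).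

Definition besov_space p a : set (borel_type X -> R) :=
  [set f | f \in Lfun mu p%:E /\
    ereal_sup [set KS_energy p a f r | r in [set r : R | (0 < r)%R]] < +oo].

Definition KS_space p a : set (borel_type X -> R) :=
  [set f | f \in Lfun mu p%:E /\ limf_esup (KS_energy p a f) 0^'+ < +oo].

Definition ae_constant f : Prop := exists c : R, {ae mu, forall x, f x = c}.

Definition crit_exponent p : \bar R :=
  ereal_sup [set a%:E | a in [set a : R | (0 <= a)%R /\
    exists2 f, besov_space p a f & ~ ae_constant f]].

Definition property_P p a : Prop :=
  (exists2 f, KS_space p a f & ~ ae_constant f) /\
  exists2 C : R, (1 <= C)%R & forall f, KS_space p a f ->
    ereal_sup [set KS_energy p a f r | r in [set r : R | (0 < r)%R]]
      <= C%:E * limf_einf (KS_energy p a f) 0^'+.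

(* fine is harmless here: property_P p a forces crit_exponent p = a%:E. *)
Definition p_variation p f : \bar R :=
  limf_einf (fun r => KS_energy p (fine (crit_exponent p)) f r `^ p^-1) 0^'+.

End KorevaarSchoen.

(* May be negative, when Q < a * p. *)
Definition sobolev_exponent {R : realType} (p Q a : R) : \bar R :=
  if Q == a * p then +oo%E else (p * Q / (Q - a * p))%:E.

(* Main.v *)
Require Import Defs.
From mathcomp Require Import all_boot all_order all_algebra.
From mathcomp Require Import all_classical all_reals all_analysis.
From mathcomp Require Import measurable_realfun ess_sup_inf ring lra.

Import Order.TTheory GRing.Theory Num.Theory.
Import numFieldNormedType.Exports.

Local Open Scope classical_set_scope.
Local Open Scope ring_scope.
Local Open Scope ereal_scope.

(** The energy [KS_energy p a f r] sees the variation of [f] at scale [r]. The proof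
    is the truncation method of Bakry, Coulhon, Ledoux and Saloff-Coste, which
    deduces Sobolev inequalities from decay estimates for the measure [N t] of the
    superlevel sets [{|f| >= t}].

    Cut [f] at levels [t 0 <= t 1 <= ...] into parts [f_i], where [f_i] follows [|f|]
    between [t i] and [t i.+1] and is constant elsewhere. Since [p >= 1], the sum of
    [|f_i y - f_i x| ^ p] is at most [|f y - f x| ^ p], so that the energies of the
    parts add up to at most the energy of [f]. Property [property_P] compares the
    energy of [f_i] at any radius with its lower limit at 0; lower limits being
    superadditive, the energies of the parts at freely chosen radii add up to at most
    a constant times [p_variation p f ^ p] ([sum_band_energy_le]).

    The radius for the band starting at level [t] is the one for which every ball has
    measure at least [2 N t]; it exists, comparable to [N t ^ (1 / Q)], by volume
    growth and non-collapsing, unless [N t] is large, in which case the [L^p] norm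
    of the part takes over. Around each point of [{|f| >= t'}], at least half of
    the ball of this radius lies outside [{|f| >= t}], which bounds the energy
    from below and gives, with [g = a p / Q],
    [sum_i (t i.+1 - t i) ^ p * N (t i.+1) * N (t i) ^ (- g) <= C * A ^ p],
    where [A] is the sum of the [L^p] norm and of the variation
    ([band_bound_level_mass]). Everything else concerns the nonincreasing function
    [N] of a real variable.

    For [r] finite, dyadic levels turn this estimate into a recurrence between
    [t ^ r * N t] at the levels [t / 2] and [t], into which the moment of order [s] is
    interpolated; solving it gives the inequality whatever the sign of
    [Q - a p] ([dyadic_interpolation]). For [r] infinite, [N] has to vanish beyond
    some level: for [g > 1] by the iteration of De Giorgi and Stampacchia
    ([band_bound_support]), and for [g = 1] and [p = 1] by multiplying the
    estimates over [n] equal bands and letting [n] tend to infinity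
    ([band_bound11_support]).

    The variation is defined at the critical exponent, which is [a]
    ([crit_exponentE]). The integrand of the outer integral of an energy is not known
    to be measurable: this integral is used as a lower integral only. *)

(** * Decay of a distribution function across bands of levels *)

Section LevelSetDecay.
Local Open Scope ring_scope.
Context {R : realType}.
Implicit Types (N : R -> R) (p g r s th K P S D M t c d x y : R).

(** For [N t] the measure of [{|f| >= t}], each term is, up to a constant, a lower
    bound for the [p]-energy of the part of [f] between the levels [t i] and
    [t i.+1]. The sum over consecutive bands is kept because these energies add
    up to at most the energy of [f]: the bound on one band alone only gives
    weak-type estimates. *)
Definition band_bound p g K N := forall (t : nat -> R) n, 0 < t 0%N ->
  (forall i, t i <= t i.+1) ->
  \sum_(i < n) (t i.+1 - t i) `^ p * N (t i.+1) * N (t i) `^ (- g) <= K.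

(** Discrete form of [\int |f| ^ r <= D], uniform in the starting level [t] so
    that no summation over negative powers of 2 is needed. *)
Definition dyadic_bound r D N := forall t n, 0 < t ->
  \sum_(i < n) (t * 2 ^+ i) `^ r * N (t * 2 ^+ i) <= D.

Lemma dyadic_bound1 r D N t : dyadic_bound r D N -> 0 < t ->
  t `^ r * N t <= D.
Proof. by move=> /(_ t 1%N) /[apply]; rewrite big_ord1 expr0 mulr1. Qed.

Lemma band_bound1 p g K N s t : 0 < g -> band_bound p g K N ->
    (forall u, 0 <= N u) -> (forall x y, 0 < x -> x <= y -> N y <= N x) ->
    0 < s -> s <= t ->
  (t - s) `^ p * N t <= K * N s `^ g.
Proof.
move=> g0 bN N0 Nd s0 st.
have [Ns0|Ns] := eqVneq (N s) 0.
  have -> : N t = 0 by apply/eqP; rewrite eq_le N0 andbT -Ns0 Nd.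
  by rewrite mulr0 Ns0 powR0 ?mulr0// gt_eqF.
have /= := bN (fun i => if i == 0%N then s else t) 1%N s0.
rewrite big_ord1/= => /(_ _)/wrap[].
  by case.
rewrite powRN ler_pdivrMr ?powR_gt0//.
by rewrite lt_neqAle eq_sym Ns N0.
Qed.

(** The algebra behind the interpolation: [N t] is split as
    [N t ^ x * N t ^ (1 - x)], the first factor is bounded through the band
    [t / 2, t] and the second is kept for the exponent [s]. The relation between
    [r], [p], [s] and [x] says that all powers of [t] cancel; after taking
    logarithms the claim is linear in [ln t], [ln (N t)], [ln a] and
    [ln (N (t / 2))]. *)
Lemma level_step N p g r s x t (c := 2 `^ (x * (p + r * g))) (a : R) :
    0 < t -> (forall u, 0 <= N u) -> 0 < g -> 0 <= x ->
    r = p * x + s * (1 - x) + r * g * x ->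
    (t / 2) `^ p * N t <= a * N (t / 2) `^ g ->
  t `^ r * N t <=
    c * (a `^ x * (t `^ s * N t) `^ (1 - x)) * ((t / 2) `^ r * N (t / 2)) `^ (g * x).
Proof.
move=> t0 N0 g0 x0 rE.
have h0 : 0 < t / 2 by rewrite divr_gt0.
have [->|Nt] := eqVneq (N t) 0.
  by move=> _; rewrite mulr0 !mulr_ge0 ?powR_ge0.
have {}Nt : 0 < N t by rewrite lt_neqAle eq_sym Nt N0.
have [->|Nh] := eqVneq (N (t / 2)) 0.
  rewrite powR0 ?(gt_eqF g0)// mulr0 => /le_gtF.
  by rewrite mulr_gt0// powR_gt0.
have {}Nh : 0 < N (t / 2) by rewrite lt_neqAle eq_sym Nh N0.
move=> H.
have a0 : 0 < a.
  rewrite -(pmulr_lgt0 _ (powR_gt0 g Nh)); apply: lt_le_trans H.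
  by rewrite mulr_gt0// powR_gt0.
move: H; rewrite -ler_ln ?posrE ?mulr_gt0 ?powR_gt0 ?mulr_gt0 ?powR_gt0// => H.
rewrite -ler_ln ?posrE ?mulr_gt0 ?powR_gt0 ?mulr_gt0 ?powR_gt0//.
move: H; rewrite /c !(lnM, ln_powR) ?posrE ?mulr_gt0 ?powR_gt0 ?mulr_gt0 ?powR_gt0 ?invr_gt0//.
rewrite !lnV ?posrE//.
move: (ln t) (ln (N t)) (ln a) (ln (N (t / 2))) (ln 2) => T A B C E H.
have : x * (p * (T - E) + A) <= x * (B + g * C) by rewrite ler_wpM2l.
move=> H'.
rewrite -subr_ge0 in H'; rewrite -subr_ge0.
rewrite [X in 0 <= X](_ : _ = x * (B + g * C) - x * (p * (T - E) + A) + (p * x + s * (1 - x) + r * g * x - r) * T)//; last by ring.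
by rewrite -rE subrr mul0r addr0.
Qed.

Lemma powRD_gt0 x (u v : R) : 0 < x -> x `^ (u + v) = x `^ u * x `^ v.
Proof. by move=> x0; apply: powRD; rewrite (gt_eqF x0) implybT. Qed.

Lemma powR2_sub1_gt0 x : 0 < x -> 0 < 2 `^ x - 1.
Proof.
move=> x0; have := @gt0_ltr_powR _ _ x0 1 2; rewrite !nnegrE powR1 subr_gt0.
by apply => //; rewrite ltr1n.
Qed.

Lemma le_self_powR c y d : 0 <= y -> 0 <= c -> 0 < d ->
  y <= c * y `^ (1 - d) -> y <= c `^ d^-1.
Proof.
rewrite le_eqVlt => /predU1P[<- *|y0 c0 d0 yc]; first exact: powR_ge0.
have yd : y `^ d <= c.
  rewrite -(ler_pM2r (powR_gt0 (1 - d) y0)) -powRD_gt0//.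
  by rewrite [d + _]addrC subrK powRr1// ltW.
have -> : y = (y `^ d) `^ d^-1.
  by rewrite -powRrM mulfV ?gt_eqF// powRr1// ltW.
by rewrite ge0_ler_powR ?nnegrE ?powR_ge0 ?invr_ge0// ltW.
Qed.

(** Taking the supremum [B] of [b] over [`]0, T]] on both sides of the recurrence
    gives [B <= c * B ^ (1 - d)]; dividing by [B ^ (1 - d)] is possible because the
    a priori bound makes [B] finite. *)
Lemma self_improving (b : R -> R) c d : 0 <= c -> 0 < d -> d <= 1 ->
    (forall t, 0 < t -> 0 <= b t) ->
    (forall T, 0 < T -> exists M, forall t, 0 < t -> t <= T -> b t <= M) ->
    (forall t, 0 < t -> b t <= c * b (t / 2) `^ (1 - d)) ->
  forall t, 0 < t -> b t <= c `^ d^-1.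
Proof.
move=> c0 d0 d1 b0 bM bstep T T0.
pose E := [set b t | t in [set t | 0 < t <= T]].
have ET : E (b T) by exists T => //=; rewrite T0 lexx.
have supE : has_sup E.
  split; first by exists (b T).
  have [M HM] := bM T T0.
  by exists M => _ [t /andP[t0 tT] <-]; exact: HM.
have bE t : 0 < t -> t <= T -> b t <= sup E.
  by move=> t0 tT; apply: ub_le_sup; [case: supE|exists t => //=; rewrite t0].
have E0 : 0 <= sup E by rewrite (le_trans (b0 T T0))// bE.
apply: le_trans (bE T T0 (lexx _)) _.
apply: le_self_powR => //.
apply: ge_sup; first by exists (b T).
move=> _ [t /andP[t0 tT] <-]; apply: le_trans (bstep t t0) _.
have t20 : 0 < t / 2 by rewrite divr_gt0.
rewrite ler_wpM2l// ge0_ler_powR ?nnegrE ?b0 ?subr_ge0// bE//.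
by rewrite (le_trans _ tT)// ler_pdivrMr// ler_peMr// ?ler1n// ltW.
Qed.

Lemma weighted_geo_le x (u v : R) : 0 <= x -> x <= 1 -> 0 <= u -> 0 <= v ->
  u `^ x * v `^ (1 - x) <= u + v.
Proof.
move=> x0 x1 u0 v0.
have H (w z : R) : 0 <= w -> w <= z -> w `^ x * z `^ (1 - x) <= z /\ z `^ x * w `^ (1 - x) <= z.
  rewrite le_eqVlt => /predU1P[<- z0|w0 wz].
    have [->|xn0] := eqVneq x 0.
      by rewrite !powRr0 subr0 !mul1r !powRr1.
    rewrite powR0// mul0r z0; split=> //.
    have [->|x1'] := eqVneq x 1; first by rewrite subrr powRr0 mulr1 powRr1.
    by rewrite powR0 ?mulr0// subr_eq0 eq_sym.
  have z0 : 0 < z by exact: lt_le_trans wz.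
  have zE : z = z `^ x * z `^ (1 - x).
    by rewrite -powRD_gt0// [x + _]addrC subrK powRr1// ltW.
  split; rewrite [X in _ <= X]zE ?ler_wpM2r ?ler_wpM2l ?powR_ge0//;
    by rewrite ge0_ler_powR ?nnegrE ?subr_ge0 ?(ltW z0) ?(ltW w0).
have [uv|/ltW vu] := leP u v.
  by rewrite (le_trans (H u v u0 uv).1)// lerDr.
by rewrite (le_trans (H v u v0 vu).2)// lerDl.
Qed.

(** Hoelder's inequality for sums; the factor 2 comes from replacing the weighted
    arithmetic-geometric inequality by [u ^ x * v ^ (1 - x) <= u + v]. *)
Lemma sum_weighted_geo_le x K S n (a e : 'I_n -> R) :
    0 <= x -> x <= 1 -> 0 < K -> 0 < S ->
    (forall i, 0 <= a i) -> (forall i, 0 <= e i) ->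
    \sum_i a i <= K -> \sum_i e i <= S ->
  \sum_i a i `^ x * e i `^ (1 - x) <= 2 * (K `^ x * S `^ (1 - x)).
Proof.
move=> x0 x1 K0 S0 a0 e0 aK eS.
have KS : 0 < K `^ x * S `^ (1 - x) by rewrite mulr_gt0 ?powR_gt0.
have -> : \sum_i a i `^ x * e i `^ (1 - x) =
   (\sum_i (a i / K) `^ x * (e i / S) `^ (1 - x)) * (K `^ x * S `^ (1 - x)).
  rewrite mulr_suml; apply: eq_bigr => i _.
  rewrite mulrACA -!powRM ?divr_ge0 ?a0 ?e0 ?(ltW K0) ?(ltW S0)//.
  by rewrite !divfK ?gt_eqF.
rewrite ler_wpM2r ?(ltW KS)//.
apply: (@le_trans _ _ (\sum_i (a i / K + e i / S))).
  by apply: ler_sum => i _; rewrite weighted_geo_le// divr_ge0 ?a0 ?e0// ltW.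
rewrite big_split/= -!mulr_suml.
by apply: (@le_trans _ _ (1 + 1)) => //; rewrite lerD// ler_pdivrMr// mul1r.
Qed.

(** With [x = th r / (p + th r g)] the step inequality reads
    [b t <= c * a ^ x * sigma ^ (1 - x) * b (t / 2) ^ (g x)] for
    [b t = t ^ r * N t] and [sigma = t ^ s * N t], and [g x < 1]. Bounding [a] by
    [K] and [sigma] by [S] first yields a uniform bound on [b] (the weak-type
    estimate). Inserting it in the last factor and summing over dyadic levels
    then gives the strong-type estimate, since [sum a <= K] and
    [sum sigma <= S]. The argument is the same for [g] below, equal to or above 1.
    The bound [P] on the [p]-th moment is what makes [b] bounded near 0 if [p <= r]. *)
Lemma dyadic_interpolation p g r s th : 1 <= p -> 0 < g -> 0 < r -> 0 < s ->
    0 < th -> th <= 1 -> r^-1 = th * (1 - g) / p + (1 - th) / s ->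
  exists2 C : R, 0 < C & forall N K S P, 0 < K -> 0 < S ->
    (forall u, 0 <= N u) -> (forall x y, 0 < x -> x <= y -> N y <= N x) ->
    dyadic_bound p P N -> band_bound p g K N -> dyadic_bound s S N ->
    dyadic_bound r (C * (K `^ (th * r / p) * S `^ ((1 - th) * r / s))) N.
Proof.
move=> p1 g0 r0 s0 th0 th1 rE.
have p0 : 0 < p by exact: lt_le_trans p1.
pose w := p + th * r * g.
have w0 : 0 < w by rewrite addr_gt0 ?mulr_gt0.
pose x := th * r / w.
have x0 : 0 < x by rewrite divr_gt0 ?mulr_gt0.
have dE : 1 - g * x = p / w.
  rewrite (_ : p = w - th * r * g) /x; last by rewrite /w addrK.
  by field; rewrite gt_eqF.
have dE' : 1 - p / w = g * x by rewrite -dE; ring.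
have d0 : 0 < p / w by rewrite divr_gt0.
have d1 : p / w <= 1 by rewrite ler_pdivrMr// mul1r lerDl !mulr_ge0 ?ltW.
have rE' : p * s = r * (th * (1 - g) * s + (1 - th) * p).
  have : p * s * r * r^-1 = p * s * r * (th * (1 - g) / p + (1 - th) / s) by rewrite rE.
  rewrite mulfK ?gt_eqF// => ->; field; by rewrite !gt_eqF.
have x1E : 1 - x = (p / w) * ((1 - th) * r / s).
  have -> : p / w * ((1 - th) * r / s) = (r * (1 - th) * p / s) / w.
    by field; rewrite !gt_eqF.
  have -> : 1 - x = (w - th * r) / w by rewrite /x; field; rewrite gt_eqF.
  congr (_ / _); apply: (mulIf (lt0r_neq0 s0)); rewrite divfK ?gt_eqF//.
  by rewrite /w !mulrDl rE'; ring.
have x1 : x <= 1.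
  by rewrite -subr_ge0 x1E !mulr_ge0 ?invr_ge0 ?subr_ge0// ltW.
have xE : x = (p / w) * (th * r / p) by rewrite /x; field; rewrite !gt_eqF.
have rx : r = p * x + s * (1 - x) + r * g * x.
  apply: (@mulIf _ w); first by rewrite gt_eqF.
  have -> : (p * x + s * (1 - x) + r * g * x) * w = p * (th * r) + s * (w - th * r) + r * g * (th * r).
    rewrite /x; field; by rewrite gt_eqF.
  by rewrite /w !mulrDr [s * p]mulrC rE'; ring.
pose c := 2 `^ (x * (p + r * g)).
have c0 : 0 < c by rewrite powR_gt0.
exists (c * 2 * c `^ ((1 - p / w) / (p / w))); first by rewrite !mulr_gt0 ?powR_gt0.
move=> N K S P K0 S0 N0 Nd bP bK bS.
pose b t := t `^ r * N t.
have b0 t : 0 <= b t by rewrite mulr_ge0 ?powR_ge0.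
pose L := K `^ x * S `^ (1 - x).
have L0 : 0 < L by rewrite mulr_gt0 ?powR_gt0.
have weak t : 0 < t -> b t <= (c * L) `^ (p / w)^-1.
  apply: self_improving => //; first by rewrite mulr_ge0// ltW.
    move=> T T0.
    suff [e [G [e0 HG]]] : exists e G, e <= r /\ dyadic_bound e G N.
      exists (T `^ (r - e) * G) => u u0 uT.
      have -> : b u = u `^ (r - e) * (u `^ e * N u).
        by rewrite mulrA -powRD_gt0// subrK.
      rewrite ler_pM ?mulr_ge0 ?powR_ge0//.
        by rewrite ge0_ler_powR ?nnegrE ?subr_ge0 ?(ltW u0) ?(ltW T0).
      exact: dyadic_bound1.
    have [pr|rp] := leP p r; first by exists p, P.
    exists s, S; split => //.
    (* 1/r is at most the barycenter of 1/p and 1/s, so that r < p forces s <= r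
       and the bound near 0 comes from S *)
    rewrite leNgt; apply/negP => rs.
    have : p * s <= r * (th * s + (1 - th) * p).
      rewrite rE' ler_wpM2l ?(ltW r0)// lerD2r ler_wpM2r ?(ltW s0)//.
      by rewrite ger_pMr// gerBl ltW.
    apply/negP; rewrite -ltNge.
    have -> : p * s = p * (th * s) + s * ((1 - th) * p) by ring.
    rewrite mulrDr ltr_leD//; first by rewrite ltr_pM2r// mulr_gt0.
    by rewrite ler_wpM2r ?(ltW rs)// mulr_ge0 ?subr_ge0// ltW.
  move=> u u0.
  have u20 : 0 < u / 2 by rewrite divr_gt0.
  have := @level_step N p g r s x u K u0 N0 g0 (ltW x0) rx.
  move=> /(_ _)/wrap[].
    have {1}-> : u / 2 = u - u / 2 by field.
    by apply: band_bound1 => //; rewrite ler_pdivrMr// ler_peMr ?ler1n// ltW.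
  rewrite -/c -/(b u) -/(b (u / 2)) => /le_trans; apply.
  rewrite dE' ler_wpM2r ?powR_ge0// ler_wpM2l ?(ltW c0)//.
  rewrite ler_wpM2l ?powR_ge0// ge0_ler_powR ?nnegrE ?mulr_ge0 ?powR_ge0 ?subr_ge0 ?(ltW S0)//.
  exact: dyadic_bound1.
move=> t n t0.
pose tau i := t / 2 * 2 ^+ i.
have tau0 i : 0 < tau i by rewrite mulr_gt0 ?divr_gt0 ?exprn_gt0.
have tauS i : tau i.+1 = t * 2 ^+ i by rewrite /tau exprS; field.
have tau2 i : tau i.+1 / 2 = tau i by rewrite /tau exprS; field.
have tauB i : tau i.+1 - tau i = tau i by rewrite /tau exprS; field.
pose a i := (tau i) `^ p * N (tau i.+1) * N (tau i) `^ (- g).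
have aK : \sum_(i < n) a i <= K.
  have := bK tau n (tau0 0%N) => /(_ _)/wrap[].
    by move=> i; rewrite -subr_ge0 tauB ltW.
  by under eq_bigr do rewrite tauB.
have {}bS : \sum_(i < n) tau i.+1 `^ s * N (tau i.+1) <= S.
  by under eq_bigr do rewrite tauS; exact: bS.
have step i : b (tau i.+1) <=
    c * (a i `^ x * (tau i.+1 `^ s * N (tau i.+1)) `^ (1 - x)) * (c * L) `^ ((1 - p / w) / (p / w)).
  have := @level_step N p g r s x (tau i.+1) (a i) (tau0 _) N0 g0 (ltW x0) rx.
  rewrite tau2 => /(_ _)/wrap[].
    rewrite /a powRN; have [Nt0|Nt] := eqVneq (N (tau i)) 0.
      have -> : N (tau i.+1) = 0.
        apply/eqP; rewrite eq_le N0 andbT -Nt0 Nd//.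
        by rewrite -subr_ge0 tauB ltW.
      by rewrite !(mulr0, mul0r).
    rewrite divfK// gt_eqF// powR_gt0//.
    by rewrite lt_neqAle eq_sym Nt N0.
  rewrite -/(b _) -/(b _) -/c => /le_trans; apply.
  rewrite ler_wpM2l ?mulr_ge0 ?powR_ge0//.
  rewrite [(1 - p / w) / _]mulrC dE' [(c * L) `^ (_ * _)]powRrM ge0_ler_powR ?nnegrE ?powR_ge0 ?b0//.
    by rewrite mulr_ge0 ?(ltW g0) ?(ltW x0).
  exact: weak.
under eq_bigr do rewrite -tauS.
apply: le_trans; first by apply: ler_sum => i _; exact: step.
rewrite -mulr_suml -mulr_sumr.
have aS : \sum_(i < n) a i `^ x * (tau i.+1 `^ s * N (tau i.+1)) `^ (1 - x) <= 2 * L.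
  by apply: sum_weighted_geo_le => // [|i|i]; rewrite ?(ltW x0)// ?mulr_ge0 ?powR_ge0.
apply: (@le_trans _ _ (c * (2 * L) * (c * L) `^ ((1 - p / w) / (p / w)))).
  by rewrite ler_wpM2r ?powR_ge0// ler_wpM2l ?(ltW c0).
have -> : K `^ (th * r / p) * S `^ ((1 - th) * r / s) = L `^ (p / w)^-1.
  rewrite /L powRM ?powR_ge0// -!powRrM.
  by congr (_ `^ _ * _ `^ _); rewrite ?x1E ?xE; field; rewrite !gt_eqF.
have -> : L `^ (p / w)^-1 = L * L `^ ((1 - p / w) / (p / w)).
  rewrite -{2}(powRr1 (ltW L0)) -powRD_gt0//; congr (_ `^ _).
  by field; rewrite !gt_eqF.
rewrite powRM ?(ltW c0) ?(ltW L0)//.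
by rewrite le_eqVlt; apply/orP; left; apply/eqP; ring.
Qed.

End LevelSetDecay.

Section LevelSetDecayBounded.
Local Open Scope ring_scope.
Context {R : realType}.
Implicit Types (N : R -> R) (p g r s th K S D M t c d x y z u : R).

Lemma dyadic_bound_cutoff N M q r D : 0 <= M -> q <= r ->
    (forall t, 0 <= N t) -> (forall t, M < t -> N t = 0) ->
  dyadic_bound q D N -> dyadic_bound r (M `^ (r - q) * D) N.
Proof.
move=> M0 qr N0 NM bD t n t0.
apply: (@le_trans _ _ (M `^ (r - q) *
    \sum_(i < n) (t * 2 ^+ i) `^ q * N (t * 2 ^+ i))); last first.
  by rewrite ler_wpM2l ?powR_ge0// bD.
rewrite mulr_sumr; apply: ler_sum => i _.
have ti : 0 < t * 2 ^+ i by rewrite mulr_gt0 ?exprn_gt0.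
have [/NM ->|tM] := ltP M (t * 2 ^+ i); first by rewrite !mulr0.
have -> : (t * 2 ^+ i) `^ r = (t * 2 ^+ i) `^ (r - q) * (t * 2 ^+ i) `^ q.
  by rewrite -powRD_gt0// subrK.
rewrite -mulrA ler_wpM2r ?mulr_ge0 ?powR_ge0//.
by rewrite ge0_ler_powR ?nnegrE ?subr_ge0// ltW.
Qed.

Lemma le0_geometric u c z : 0 <= z -> z < 1 ->
  (forall n, u <= c * z ^+ n) -> u <= 0.
Proof.
move=> z0 z1 uc.
have zn : c * z ^+ n @[n --> \oo] --> (c * 0 : R).
  by apply: cvgMl_tmp; apply: cvg_expr; rewrite ger0_norm.
rewrite mulr0 in zn.
by rewrite -(cvg_lim _ zn)//; apply: limr_ge; [exact: cvgP zn|exact: nearW].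
Qed.

(** For [p = g = 1] a band of height [h] gives [h * N (s + h) <= e * N s] with
    [sum e <= K]. Cutting [t / 2, t] into [n] equal bands and multiplying,
    [(t / 2n) ^ n * N t <= (prod e) * N (t / 2) <= (K / n) ^ n * N (t / 2)] by
    the arithmetic-geometric inequality, so that [N t <= (2 K / t) ^ n * N (t / 2)]
    for every [n], which forces [t <= 2 K] if [N t > 0]. *)
Lemma band_bound11_support K N : 0 < K -> (forall u, 0 <= N u) ->
    (forall x y, 0 < x -> x <= y -> N y <= N x) -> band_bound 1 1 K N ->
  forall t, 0 < t -> 0 < N t -> t <= 2 * K.
Proof.
move=> K0 N0 Nd bK t t0 Nt; rewrite leNgt; apply/negP => Kt.
pose z := 2 * K / t.
have z0 : 0 <= z by rewrite divr_ge0 ?mulr_ge0// ltW.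
have z1 : z < 1 by rewrite ltr_pdivrMr// mul1r.
suff : forall n, N t <= N (t / 2) * z ^+ n.
  by move/(le0_geometric _ _ _ z0 z1); rewrite leNgt Nt.
case=> [|n].
  by rewrite expr0 mulr1 Nd ?divr_gt0// ler_pdivrMr// ler_peMr ?ler1n// ltW.
pose h := t / 2 / n.+1%:R.
have h0 : 0 < h by rewrite !divr_gt0.
pose s (i : nat) := t / 2 + i%:R * h.
have sB i : s i.+1 - s i = h by rewrite /s -natr1; ring.
have sS i : s i <= s i.+1 by rewrite -subr_ge0 sB ltW.
have s0 : 0 < s 0%N by rewrite /s mul0r addr0 divr_gt0.
pose e (i : nat) := h * N (s i.+1) * (N (s i))^-1.
have eK : \sum_(i < n.+1) e i <= K.
  have := bK s n.+1 s0 sS; congr (_ <= _); apply: eq_bigr => i _.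
  by rewrite sB powRr1 ?(ltW h0)// powR_inv1.
have prodE m : h ^+ m * N (s m) = (\prod_(i < m) e i) * N (s 0%N).
  elim: m => [|m IH]; first by rewrite big_ord0 expr0.
  rewrite big_ord_recr/= [RHS]mulrAC -IH exprSr /e.
  have [Nm|Nm] := eqVneq (N (s m)) 0; last by field.
  have -> : N (s m.+1) = 0.
    apply/eqP; rewrite eq_le N0 andbT -Nm Nd//.
    by rewrite (lt_le_trans s0)// lerD2l mul0r mulr_ge0 ?ler0n ?(ltW h0).
  by rewrite !(mulr0, mul0r).
have agm : \prod_(i < n.+1) e i <= (K / n.+1%:R) ^+ n.+1.
  have := (@leif_AGM R 'I_n.+1 predT (fun i => e i)).
  rewrite card_ord => /(_ _)/wrap[|H].
    by move=> i _; rewrite !mulr_ge0 ?invr_ge0// ltW.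
  apply: le_trans H.1 _.
  rewrite lerXn2r ?nnegrE ?divr_ge0 ?(ltW K0) ?ler0n ?sumr_ge0//.
    by move=> i _; rewrite !mulr_ge0 ?invr_ge0// ltW.
  by rewrite ler_wpM2r ?invr_ge0 ?ler0n.
have sn : s n.+1 = t.
  by rewrite /s /h [_ * (_ / _)]mulrC divfK ?pnatr_eq0// -splitr.
have := prodE n.+1; rewrite sn {1}/s mul0r addr0 => prodE'.
have zE : z = K / n.+1%:R / h.
  have := pnatr_eq0 R n.+1; rewrite /z /h; move: (n.+1%:R : R) => m m0.
  by field; rewrite (gt_eqF t0) m0.
rewrite zE expr_div_n mulrA ler_pdivlMr ?exprn_gt0// [N t * _]mulrC prodE'.
by rewrite [X in _ <= X]mulrC ler_wpM2r.
Qed.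

(** The iteration of De Giorgi and Stampacchia along the levels
    [t0 + d (1 - 2 ^ -i)]: as [g > 1], the value of [N] decays geometrically in
    [i] once [d] is large enough with respect to [N t0]; the value of [d] makes
    the induction step an equality. *)
Lemma stampacchia p g K N t0 : 0 < p -> 1 < g -> 0 < K ->
    (forall u, 0 <= N u) -> (forall x y, 0 < x -> x <= y -> N y <= N x) ->
    band_bound p g K N -> 0 < t0 -> 0 < N t0 ->
    let d := (2 `^ (p + p / (g - 1)) * K * N t0 `^ (g - 1)) `^ p^-1 in
  N (t0 + d) = 0.
Proof.
move=> p0 g1 K0 N0 Nd bK t00 Nt0 d.
have g0 : 0 < g by exact: lt_trans g1.
have g10 : 0 < g - 1 by rewrite subr_gt0.
have d0 : 0 < d by rewrite powR_gt0 ?mulr_gt0 ?powR_gt0.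
have dp : d `^ p = 2 `^ (p + p / (g - 1)) * K * N t0 `^ (g - 1).
  by rewrite -powRrM mulVf ?gt_eqF// powRr1// !mulr_ge0 ?powR_ge0// ltW.
pose rho : R := 2 `^ (- (p / (g - 1))).
have rho0 : 0 < rho by rewrite powR_gt0.
have rho1 : rho < 1.
  have e0 : 0 < p / (g - 1) by rewrite divr_gt0.
  rewrite /rho powRN invf_lt1 ?powR_gt0//.
  have := @gt0_ltr_powR _ _ e0 1 2; rewrite !nnegrE powR1; apply => //.
  by rewrite ltr1n.
pose s (i : nat) := t0 + d * (1 - 2 ^- i).
have s0 i : 0 < s i.
  rewrite ltr_wpDr// mulr_ge0 ?(ltW d0)// subr_ge0 invf_le1 ?exprn_gt0//.
  by rewrite exprn_ege1// ler1n.
have claim i : N (s i) <= N t0 * rho ^+ i.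
  elim: i => [|i IH]; first by rewrite /s !expr0 invr1 subrr mulr0 addr0 mulr1.
  have sB : s i.+1 - s i = d * 2 ^- i.+1.
    by rewrite /s exprS; field; rewrite expf_neq0.
  have d2 : 0 < d * 2 ^- i.+1 by rewrite mulr_gt0 ?invr_gt0 ?exprn_gt0.
  have := @band_bound1 _ p g K N (s i) (s i.+1) g0 bK N0 Nd (s0 i).
  rewrite -subr_ge0 sB => /(_ (ltW d2)) H.
  rewrite -(ler_pM2l (powR_gt0 p d2)); apply: le_trans H _.
  apply: (@le_trans _ _ (K * (N t0 * rho ^+ i) `^ g)).
    by rewrite ler_wpM2l ?(ltW K0)// ge0_ler_powR ?nnegrE ?mulr_ge0 ?exprn_ge0// ltW.
  rewrite !powRM ?(ltW Nt0) ?(ltW d0) ?exprn_ge0 ?invr_ge0 ?(ltW rho0) ?exprn_ge0//.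
  rewrite dp -!powR_invn// -!powR_mulrn ?(ltW rho0)// /rho -!powRrM.
  have -> : N t0 `^ g = N t0 `^ (g - 1) * N t0.
    by rewrite -[X in _ = _ * X]powRr1 ?(ltW Nt0)// -powRD_gt0// subrK.
  set A : R := 2 `^ _; set B : R := 2 `^ _; set B' : R := 2 `^ _; set A' : R := 2 `^ _.
  have AB : A = B * B' * A'.
    rewrite /A /B /B' /A' -!powRD_gt0//; congr (_ `^ _).
    by rewrite -natr1; field; rewrite gt_eqF.
  by rewrite AB le_eqVlt; apply/orP; left; apply/eqP; ring.
apply/eqP; rewrite eq_le N0 andbT.
apply: (le0_geometric _ (N t0) rho) => //; first exact: ltW.
move=> n; apply: le_trans (claim n); apply: Nd => //.
by rewrite lerD2l ger_pMr// gerBl invr_ge0 exprn_ge0.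
Qed.

(** The support of [N] ends before [l + d], with [d] provided by the iteration
    from the level [l]. As [N l <= S / l ^ s], [d] is at most a constant times
    [K ^ (1 / p) * (S / l ^ s) ^ ((g - 1) / p)], and [l] below is the level for
    which this is equal to [l]. *)
Lemma band_bound_support p g s th : 0 < p -> 1 < g -> 0 < s -> 0 < th ->
    0 = th * (1 - g) / p + (1 - th) / s ->
  exists2 C : R, 0 < C & forall N K S, 0 < K -> 0 < S ->
    (forall u, 0 <= N u) -> (forall x y, 0 < x -> x <= y -> N y <= N x) ->
    band_bound p g K N -> (forall t, 0 < t -> t `^ s * N t <= S) ->
    forall t, 0 < t -> 0 < N t ->
      t <= C * (K `^ (th / p) * S `^ ((1 - th) / s)).
Proof.
move=> p0 g1 s0 th0 thE.
have g10 : 0 < g - 1 by rewrite subr_gt0.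
pose c : R := 2 `^ (p + p / (g - 1)) `^ p^-1.
have c0 : 0 < c by rewrite !powR_gt0.
exists (1 + c); first by rewrite addr_gt0.
move=> N K S K0 S0 N0 Nd bK bS t t0 Nt.
set l := K `^ (th / p) * S `^ ((1 - th) / s).
have l0 : 0 < l by rewrite mulr_gt0 ?powR_gt0.
have [Nl|Nl] := eqVneq (N l) 0.
  rewrite leNgt; apply/negP => H.
  suff : N t <= 0 by rewrite leNgt Nt.
  by rewrite -Nl Nd// (le_trans _ (ltW H))// ler_peMl ?(ltW l0)// lerDl ltW.
have {}Nl : 0 < N l by rewrite lt_def Nl N0.
have := stampacchia p g K N l p0 g1 K0 N0 Nd bK l0 Nl.
set d := (2 `^ _ * K * _) `^ _ => /= Nd0.
have dl : d <= c * l.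
  have dE : (g - 1) / p * th = (1 - th) / s.
    by apply/eqP; rewrite eq_sym -subr_eq0 thE; apply/eqP; field; rewrite !gt_eqF.
  have thE' : th^-1 = 1 + s * ((g - 1) / p).
    apply: (mulIf (lt0r_neq0 th0)); rewrite mulVf ?gt_eqF// mulrDl mul1r -mulrA dE.
    by rewrite mulrC divfK ?gt_eqF// addrC subrK.
  have lE : K `^ p^-1 * S `^ ((g - 1) / p) = l `^ (1 + s * ((g - 1) / p)).
    rewrite -thE' /l powRM ?powR_ge0// -!powRrM -dE.
    by congr (_ `^ _ * _ `^ _); field; rewrite !gt_eqF.
  rewrite /d !powRM ?mulr_ge0 ?powR_ge0 ?(ltW K0)// -mulrA ler_wpM2l ?(ltW c0)//.
  rewrite -powRrM.
  have ls : 0 < l `^ (s * ((g - 1) / p)) by rewrite powR_gt0.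
  rewrite -(ler_pM2r ls) -[X in _ <= X * _](powRr1 (ltW l0)) -powRD_gt0// -lE -mulrA.
  rewrite ler_wpM2l ?powR_ge0// [l `^ _]powRrM -powRM ?powR_ge0 ?N0// [N l * _]mulrC.
  by rewrite ge0_ler_powR ?nnegrE ?mulr_ge0 ?powR_ge0 ?divr_ge0 ?(ltW g10) ?(ltW p0) ?(ltW S0)// ?invr_ge0 ?(ltW p0) ?bS.
rewrite leNgt; apply/negP => H.
suff : N t <= 0 by rewrite leNgt Nt.
rewrite -Nd0; apply: Nd; first by rewrite ltr_wpDr// powR_ge0.
by apply: le_trans (ltW H); rewrite mulrDl mul1r lerD2l.
Qed.

End LevelSetDecayBounded.

(** * Integrals of functions that need not be measurable *)

Section LowerIntegral.
Import HBNNSimple.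
Context {d : measure_display} {T : measurableType d} {R : realType}.
Variable mu : {measure set T -> \bar R}.
Implicit Types (D A : set T) (f g : T -> \bar R).

(** The integral of a nonnegative function is the supremum of the integrals of
    the simple functions below it, whether or not the function is measurable.
    In general it is then only a lower integral, which is still monotone and
    superadditive: this is what the energies require, as the measurability in
    [x] of the integrals over [ball x r] is thereby never at stake. *)
Lemma ge0_le_lower_integral D f g : (forall x, D x -> 0 <= f x) ->
    (forall x, D x -> f x <= g x) ->
  \int[mu]_(x in D) f x <= \int[mu]_(x in D) g x.
Proof.
move=> f0 fg.
have g0 x : D x -> 0 <= g x by move=> Dx; rewrite (le_trans (f0 x Dx)) ?fg.
rewrite !ge0_integralE//; apply: ereal_sup_le => _ [h /= hf <-].
exists h => //= x; apply: le_trans (hf x) _.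
by rewrite !patchE; case: ifPn => // /set_mem Dx; exact: fg.
Qed.

Lemma ereal_supD_le (A B : set (\bar R)) M :
    A !=set0 -> B !=set0 -> (forall a, A a -> 0 <= a) -> (forall b, B b -> 0 <= b) ->
    (forall a b, A a -> B b -> a + b <= M) ->
  ereal_sup A + ereal_sup B <= M.
Proof.
move=> [a0 Aa0] [b0 Bb0] A0 B0 ABM.
have [->|] := eqVneq M +oo; first exact: leey.
rewrite -ltey => Moo.
have Bfin b : B b -> b \is a fin_num.
  move=> Bb; rewrite ge0_fin_numE ?B0//; apply: le_lt_trans Moo.
  by apply: le_trans (ABM a0 b Aa0 Bb); rewrite leeDr// A0.
have supA b : B b -> ereal_sup A <= M - b.
  by move=> Bb; apply: ge_ereal_sup => a Aa; rewrite leeBrDr ?Bfin// ABM.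
have supA0 : 0 <= ereal_sup A.
  by apply: le_trans (A0 _ Aa0) _; exact: ereal_sup_ubound.
have supAfin : ereal_sup A \is a fin_num.
  rewrite ge0_fin_numE//; apply: le_lt_trans Moo; apply: le_trans (supA _ Bb0) _.
  by rewrite leeBlDr ?Bfin// leeDl// B0.
rewrite -leeBrDl//; apply: ge_ereal_sup => b Bb.
by rewrite leeBrDl// -leeBrDr ?Bfin// supA.
Qed.

Lemma lower_integral_superadditive D f g : (forall x, D x -> 0 <= f x) ->
    (forall x, D x -> 0 <= g x) ->
  \int[mu]_(x in D) f x + \int[mu]_(x in D) g x <= \int[mu]_(x in D) (f x + g x).
Proof.
move=> f0 g0.
have fg0 x : D x -> 0 <= f x + g x by move=> Dx; rewrite adde_ge0 ?f0 ?g0.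
rewrite !ge0_integralE//.
have simple0 h : (forall x, D x -> 0 <= h x) ->
    [set sintegral mu k | k in [set k : {nnsfun T >-> R} |
      forall x, (k x)%:E <= (h \_ D) x]] !=set0.
  move=> h0; exists (sintegral mu nnsfun0); exists nnsfun0 => //= x.
  by rewrite patchE; case: ifPn => // /set_mem/h0.
apply: ereal_supD_le; [exact: simple0|exact: simple0| | |].
- by move=> _ [h _ <-]; exact: sintegral_ge0.
- by move=> _ [h _ <-]; exact: sintegral_ge0.
move=> _ _ [h /= hf <-] [k /= kg <-]; rewrite -sintegralD//.
apply: ereal_sup_ubound; exists (add_nnsfun h k) => //= x.
by have := leeD (hf x) (kg x); rewrite EFinD !patchE; case: ifPn; rewrite ?adde0.
Qed.

Lemma lower_integral_sum D n (f : 'I_n -> T -> \bar R) :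
    (forall i x, D x -> 0 <= f i x) ->
  \sum_(i < n) \int[mu]_(x in D) f i x <= \int[mu]_(x in D) \sum_(i < n) f i x.
Proof.
elim: n f => [|n IH] f f0.
  by rewrite big_ord0 integral_ge0// => x _; rewrite big_ord0.
rewrite big_ord_recr/=.
rewrite (_ : (fun x => \sum_(i < n.+1) f i x) = fun x =>
    \sum_(i < n) f (widen_ord (leqnSn n) i) x + f ord_max x); last first.
  by apply/funext => x; rewrite big_ord_recr.
apply: le_trans (lower_integral_superadditive D _ _ _ _).
- by rewrite leeD2r// IH// => i x Dx; exact: f0.
- by move=> x Dx; rewrite sume_ge0// => i _; exact: f0.
- by move=> x Dx; exact: f0.
Qed.

Lemma lower_integralZl_le D f (c : R) :
    (0 <= c)%R -> (forall x, D x -> 0 <= f x) ->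
  c%:E * \int[mu]_(x in D) f x <= \int[mu]_(x in D) (c%:E * f x).
Proof.
rewrite le_eqVlt => /predU1P[<- f0|c0 f0].
  by rewrite mul0e integral_ge0// => x Dx; rewrite mule_ge0 ?f0.
rewrite -lee_pdivlMl// ge0_integralE//; apply: ge_ereal_sup => _ [h /= hf <-].
rewrite lee_pdivlMl// -sintegralrM ge0_integralE; last first.
  by move=> x Dx; rewrite mule_ge0 ?f0// lee_fin ltW.
apply: ereal_sup_ubound; exists (scale_nnsfun h (ltW c0)) => //= x.
have := hf x; rewrite !patchE; case: ifPn => _ hx.
  by rewrite EFinM lee_wpmul2l// lee_fin ltW.
by rewrite EFinM; have := @lee_wpmul2l _ c%:E (ltW c0) _ _ hx; rewrite mule0.
Qed.

Lemma lower_integral_ge D A f (c : R) : measurable D -> measurable A ->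
    A `<=` D -> (0 <= c)%R ->
    (forall x, D x -> 0 <= f x) -> (forall x, A x -> c%:E <= f x) ->
  c%:E * mu A <= \int[mu]_(x in D) f x.
Proof.
move=> mD mA AD c0 f0 fc.
have -> : c%:E * mu A = \int[mu]_(x in D) (c%:E * (\1_A x)%:E).
  rewrite ge0_integralZl//; last exact/measurable_EFinP/measurable_indic.
  by rewrite integral_indic// setIidl.
apply: ge0_le_lower_integral => x Dx; first by rewrite mule_ge0.
rewrite indicE; case: (boolP (x \in A)) => [/set_mem Ax|_].
  by rewrite mule1 fc.
by rewrite mule0 f0.
Qed.

End LowerIntegral.

(** * Superlevel sets and norms *)

Section LevelSets.
Context {d : measure_display} {T : measurableType d} {R : realType}.
Variable mu : {measure set T -> \bar R}.
Implicit Types (f : T -> R) (r s t a D M : R).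

Definition superlevel f t : set T := [set x | (t <= `|f x|)%R].

(** Meaningful for [t > 0] and [f] in some [L^p], where the measure is finite. *)
Definition level_mass f t : R := fine (mu (superlevel f t)).

Lemma measurable_superlevel f t : measurable_fun setT f ->
  measurable (superlevel f t).
Proof.
move=> mf; rewrite -[X in measurable X]setTI.
have -> : superlevel f t = (Num.norm \o f) @^-1` `[t, +oo[.
  by apply/seteqP; split => x; rewrite /superlevel/= in_itv/= andbT.
by apply: (measurableT_comp (@normr_measurable R setT) mf) => //; exact: measurable_itv.
Qed.

Lemma level_mass_ge0 f t : (0 <= level_mass f t)%R.
Proof. exact: fine_ge0. Qed.

Lemma chebyshev_superlevel f s t : measurable_fun setT f -> (0 < t)%R -> (0 < s)%R ->
  (t `^ s)%:E * mu (superlevel f t) <= \int[mu]_x (`|f x| `^ s)%:E.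
Proof.
move=> mf t0 s0; apply: lower_integral_ge => //.
- exact: measurable_superlevel.
- exact: powR_ge0.
- by move=> x tx; rewrite lee_fin ge0_ler_powR ?nnegrE ?(ltW t0) ?(ltW s0).
Qed.

Lemma superlevel_lty f s t : measurable_fun setT f -> (0 < t)%R -> (0 < s)%R ->
  \int[mu]_x (`|f x| `^ s)%:E < +oo -> mu (superlevel f t) < +oo.
Proof.
move=> mf t0 s0 fs; have := le_lt_trans (chebyshev_superlevel f s t mf t0 s0) fs.
have [->|] := eqVneq (mu (superlevel f t)) +oo; last by rewrite -ltey => ->.
by rewrite gt0_muley ?lte_fin ?powR_gt0.
Qed.

Lemma level_mass_le f x y : measurable_fun setT f ->
    (forall t, (0 < t)%R -> mu (superlevel f t) < +oo) ->
  (0 < x)%R -> (x <= y)%R -> (level_mass f y <= level_mass f x)%R.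
Proof.
move=> mf ffin x0 xy.
have y0 : (0 < y)%R by exact: lt_le_trans xy.
rewrite fine_le ?ge0_fin_numE ?ffin// le_measure ?inE//; try exact: measurable_superlevel.
by move=> z; rewrite /superlevel/=; exact: le_trans.
Qed.

Lemma sum_dyadic_le s t a n : (0 < s)%R -> (0 < t)%R -> (0 <= a)%R ->
  (\sum_(i < n | t * 2 ^+ i <= a) (t * 2 ^+ i) `^ s <=
   2 `^ s / (2 `^ s - 1) * a `^ s)%R.
Proof.
move=> s0 t0 a0.
have s1 := powR2_sub1_gt0 s s0.
have tot m : (\sum_(i < m) (t * 2 ^+ i) `^ s <= (t * 2 ^+ m) `^ s / (2 `^ s - 1))%R.
  rewrite ler_pdivlMr//; elim: m => [|m IH].
    by rewrite big_ord0 mul0r powR_ge0.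
  have tm : (0 < t * 2 ^+ m)%R by rewrite mulr_gt0 ?exprn_gt0.
  rewrite big_ord_recr/= mulrDl exprSr mulrA [X in (_ <= X)%R]powRM ?(ltW tm)//.
  by apply: le_trans (lerD IH (lexx _)) _; rewrite mulrBr mulr1 addrC subrK.
elim: n => [|n IH].
  by rewrite big_ord0 !mulr_ge0 ?invr_ge0 ?powR_ge0 ?(ltW s1).
rewrite big_mkcond big_ord_recr/= -big_mkcond/=.
have tn : (0 < t * 2 ^+ n)%R by rewrite mulr_gt0 ?exprn_gt0.
case: ifPn => tna; last by rewrite addr0.
apply: (@le_trans _ _ (\sum_(i < n.+1) (t * 2 ^+ i) `^ s)%R).
  rewrite big_ord_recr/= lerD2r big_mkcond; apply: ler_sum => i _.
  by case: ifPn => // _; exact: powR_ge0.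
apply: le_trans (tot n.+1) _; rewrite exprSr mulrA powRM ?(ltW tn)//.
rewrite -[X in (X <= _)%R]mulrA mulrC ler_wpM2l ?divr_ge0 ?powR_ge0 ?(ltW s1)//.
by rewrite ge0_ler_powR ?nnegrE ?(ltW s0) ?(ltW tn).
Qed.

(** Pointwise, the powers [(t * 2 ^ i) ^ s] of the dyadic levels below [|f x|] form
    a geometric series dominated by its last term. *)
Lemma dyadic_bound_level_mass f s : measurable_fun setT f -> (0 < s)%R ->
    \int[mu]_x (`|f x| `^ s)%:E < +oo ->
  dyadic_bound s (2 `^ s / (2 `^ s - 1) * fine (\int[mu]_x (`|f x| `^ s)%:E))
    (level_mass f).
Proof.
move=> mf s0 fs t n t0.
have Ifin : \int[mu]_x (`|f x| `^ s)%:E \is a fin_num.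
  by rewrite ge0_fin_numE// integral_ge0// => x _; rewrite lee_fin powR_ge0.
have s1 := powR2_sub1_gt0 s s0.
have ti i : (0 < t * 2 ^+ i)%R by rewrite mulr_gt0 ?exprn_gt0.
rewrite -lee_fin EFinM fineK//.
have mfs : measurable_fun setT (fun x => (`|f x| `^ s)%:E).
  apply/measurable_EFinP.
  by apply: (measurableT_comp (measurable_powR s)); exact: measurableT_comp.
rewrite -ge0_integralZl//; last by rewrite lee_fin divr_ge0 ?powR_ge0// ltW.
rewrite -sumEFin.
have -> : \sum_(i < n) ((t * 2 ^+ i) `^ s * level_mass f (t * 2 ^+ i))%:E =
  \sum_(i < n) \int[mu]_x ((t * 2 ^+ i) `^ s * \1_(superlevel f (t * 2 ^+ i)) x)%:E.
  apply: eq_bigr => i _.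
  rewrite EFinM fineK ?ge0_fin_numE ?(superlevel_lty f s)//.
  under [RHS]eq_integral do rewrite EFinM.
  have mS := measurable_superlevel f (t * 2 ^+ i) mf.
  rewrite ge0_integralZl ?lee_fin ?powR_ge0//; last exact/measurable_EFinP/measurable_indic.
  by rewrite integral_indic// setIT.
apply: le_trans (lower_integral_sum mu setT n _ _) _.
  by move=> i x _; rewrite lee_fin mulr_ge0 ?powR_ge0.
apply: ge0_le_lower_integral => x _.
  by rewrite sume_ge0// => i _; rewrite lee_fin mulr_ge0 ?powR_ge0.
rewrite sumEFin -EFinM lee_fin.
apply: le_trans (sum_dyadic_le s t `|f x| n s0 t0 (normr_ge0 _)).
rewrite [X in (_ <= X)%R]big_mkcond; apply: ler_sum => i _.
rewrite indicE/=; case: (boolP (x \in _)) => [|_].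
  by rewrite inE /superlevel/= => ->; rewrite mulr1.
by rewrite mulr0; case: ifP => // _; exact: powR_ge0.
Qed.

(** Where [2 ^ -n <= |f| < 2 ^ n], some dyadic level is at most [|f|] and at least
    [|f| / 2]; the restrictions to these sets increase to [|f| ^ r]. *)
Lemma integral_le_dyadic_bound f r D : measurable_fun setT f -> (0 < r)%R ->
    (forall t, (0 < t)%R -> mu (superlevel f t) < +oo) ->
    dyadic_bound r D (level_mass f) ->
  \int[mu]_x (`|f x| `^ r)%:E <= (2 `^ r * D)%:E.
Proof.
move=> mf r0 ffin bD.
pose A (n : nat) : set T := superlevel f (2 ^- n) `\` superlevel f (2 ^+ n).
have mA n : measurable (A n) by apply: measurableD; exact: measurable_superlevel.
pose g n x := (`|f x| `^ r * \1_(A n) x)%:E.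
have g0 n x : 0 <= g n x by rewrite lee_fin mulr_ge0 ?powR_ge0.
have mfr : measurable_fun setT (fun x => `|f x| `^ r)%R.
  by apply: (measurableT_comp (measurable_powR r)); exact: measurableT_comp.
have mg n : measurable_fun setT (g n).
  by apply/measurable_EFinP; apply: measurable_funM => //; exact: measurable_indic.
have ndg x : {homo g ^~ x : n m / (n <= m)%N >-> n <= m}.
  move=> n m nm; rewrite lee_fin ler_wpM2l ?powR_ge0// !indicE ler_nat.
  case: (boolP (x \in A n)) => //; rewrite inE => -[An1 An2].
  rewrite mem_set//; split.
    apply: le_trans An1; rewrite lef_pV2 ?posrE ?exprn_gt0//.
    by rewrite ler_eXn2l// ltr1n.
  move=> H; apply: An2; apply: le_trans H.
  by rewrite ler_eXn2l// ltr1n.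
have limg x : g n x @[n --> \oo] --> (`|f x| `^ r)%:E.
  have [fx0|fx0] := eqVneq (f x) 0%R.
    rewrite fx0 normr0 powR0 ?gt_eqF//.
    rewrite (_ : g ^~ x = cst 0) //; last first.
      by apply/funext => n; rewrite /g fx0 normr0 powR0 ?gt_eqF// mul0r.
    exact: cvg_cst.
  have {}fx0 : (0 < `|f x|)%R by rewrite normr_gt0.
  apply: cvg_near_cst.
  pose n0 := maxn (Num.trunc `|f x|).+1 (Num.trunc `|f x|^-1).+1.
  exists n0 => // n /= n0n.
  have [H1 H2] : ((Num.trunc `|f x|).+1 <= n)%N /\ ((Num.trunc `|f x|^-1).+1 <= n)%N.
    by move: n0n; rewrite geq_max => /andP[].
  have n2 : (n%:R <= 2 ^+ n :> R)%R.
    by rewrite -natrX ler_nat ltnW// ltn_expl.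
  rewrite /g indicE mem_set ?mulr1//; split; rewrite /superlevel/=.
    rewrite invf_ple ?posrE ?exprn_gt0//.
    apply: le_trans n2; apply: ltW; apply: lt_le_trans (truncnS_gt _) _.
    by rewrite ler_nat.
  apply/negP; rewrite -ltNge; apply: lt_le_trans n2.
  by apply: lt_le_trans (truncnS_gt _) _; rewrite ler_nat.
have -> : \int[mu]_x (`|f x| `^ r)%:E = \int[mu]_x limn (g ^~ x).
  by apply: eq_integral => x _; apply/esym/cvg_lim.
rewrite (monotone_convergence mu measurableT mg)//.
apply: lime_le.
  apply: ereal_nondecreasing_is_cvgn => n m nm.
  by apply: ge0_le_lower_integral => // x _; exact: ndg.
apply: nearW => n.
pose tau (i : nat) : R := (2 ^- n * 2 ^+ i)%R.
have tau0 i : (0 < tau i)%R by rewrite mulr_gt0 ?invr_gt0 ?exprn_gt0.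
have mS i : measurable (superlevel f (tau i)) by exact: measurable_superlevel.
apply: (@le_trans _ _ (\int[mu]_x
    \sum_(i < n + n) (((2 * tau i) `^ r)%:E * (\1_(superlevel f (tau i)) x)%:E))).
  apply: ge0_le_lower_integral => // x _.
  rewrite /g indicE; case: (boolP (x \in A n)) => [|_]; last first.
    by rewrite mulr0 sume_ge0// => i _; rewrite mule_ge0// lee_fin powR_ge0.
  rewrite inE mulr1 => -[An1 /negP]; rewrite -ltNge => An2.
  have scale m : (`|f x| < tau m)%R ->
      exists i : 'I_m, (tau i <= `|f x|)%R /\ (`|f x| <= 2 * tau i)%R.
    elim: m => [|m IH]; first by rewrite /tau expr0 mulr1 ltNge An1.
    have [/IH[i Hi] _|tm fm] := ltP `|f x|%R (tau m).
      by exists (widen_ord (leqnSn m) i).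
    exists ord_max; split => //=; apply: ltW; apply: lt_le_trans fm _.
    by rewrite /tau exprS mulrCA.
  have [|i [ti ti2]] := scale (n + n)%N.
    by rewrite /tau exprD mulKf// expf_neq0.
  rewrite (bigD1 i)//=; apply: le_trans (leeDl _ _); last first.
    by rewrite sume_ge0// => j _; rewrite mule_ge0// lee_fin powR_ge0.
  rewrite indicE mem_set// mule1 lee_fin ge0_ler_powR ?nnegrE ?(ltW r0)//.
  by rewrite mulr_ge0// ltW.
rewrite ge0_integral_sum//; last 2 first.
  move=> i; apply: measurable_funeM; exact/measurable_EFinP/measurable_indic.
  by move=> i x _; rewrite mule_ge0// lee_fin powR_ge0.
apply: (@le_trans _ _ (\sum_(i < n + n) (2 `^ r * (tau i `^ r * level_mass f (tau i)))%:E)).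
  apply: lee_sum => i _.
  rewrite ge0_integralZl ?lee_fin ?powR_ge0//; last exact/measurable_EFinP/measurable_indic.
  rewrite integral_indic// setIT powRM ?(ltW (tau0 _))// mulrA EFinM.
  by rewrite -EFinM EFinM [X in _ <= X]EFinM /level_mass fineK// ge0_fin_numE// ffin.
rewrite sumEFin lee_fin -mulr_sumr ler_wpM2l ?powR_ge0//.
by apply: bD; rewrite invr_gt0 exprn_gt0.
Qed.

End LevelSets.

(** * The part of a function between two levels *)

Section BandTruncation.
Local Open Scope ring_scope.
Context {R : realType}.
Implicit Types (s t w u v p a b : R).

Definition band_trunc s t u : R := Num.min (Num.max `|u| s) t - s.

Lemma band_truncD s t w u : s <= t -> t <= w ->
  band_trunc s t u + band_trunc t w u = band_trunc s w u.
Proof.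
move=> st tw; rewrite /band_trunc.
case: (leP `|u| s) => us; case: (leP `|u| t) => ut; case: (leP `|u| w) => uw;
  case: (leP s t) => ?; case: (leP t w) => ?; case: (leP s w) => ?; lra.
Qed.

Lemma band_trunc_le s t u v : `|u| <= `|v| -> band_trunc s t u <= band_trunc s t v.
Proof.
rewrite /band_trunc; move: `|u| `|v| => a b ab.
case: (leP a s) => ?; case: (leP b s) => ?; case: (leP a t) => ?;
  case: (leP b t) => ?; case: (leP s t) => ?; lra.
Qed.

Lemma band_trunc_lipschitz s t u v : s <= t ->
  `|band_trunc s t u - band_trunc s t v| <= `|u - v|.
Proof.
move=> st; apply: le_trans (ler_dist_dist u v).
rewrite /band_trunc; move: `|u| `|v| => {}u {}v.
have := ler_norm (u - v); have := ler_norm (v - u); rewrite (distrC v u).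
case: (leP u s) => ?; case: (leP v s) => ?; case: (leP u t) => ?;
  case: (leP v t) => ?; case: (leP s t) => ?;
  rewrite ler_norml => ? ?; apply/andP; split; lra.
Qed.

Lemma band_trunc0 s t : 0 < s -> s <= t -> band_trunc s t 0 = 0.
Proof.
by move=> s0 st; rewrite /band_trunc normr0 max_r ?(ltW s0)// min_l// subrr.
Qed.

Lemma band_trunc_top s t u : s <= t -> t <= `|u| -> band_trunc s t u = t - s.
Proof.
move=> st tu; rewrite /band_trunc max_l ?(le_trans st)// min_r//.
Qed.

Lemma band_trunc_bottom s t u : s <= t -> `|u| <= s -> band_trunc s t u = 0.
Proof. by move=> st us; rewrite /band_trunc max_r// min_l// subrr. Qed.

Lemma powRD_le p a b : 1 <= p -> 0 <= a -> 0 <= b ->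
  a `^ p + b `^ p <= (a + b) `^ p.
Proof.
move=> p1 a0 b0.
have p0 : 0 < p by exact: lt_le_trans p1.
have H (x y : R) : 0 <= x -> 0 <= y -> x `^ p <= x * (x + y) `^ (p - 1).
  move=> x0 y0; rewrite -mulr_powRB1// ler_wpM2l//.
  by rewrite ge0_ler_powR ?nnegrE ?subr_ge0 ?addr_ge0 ?lerDl.
rewrite -[X in _ <= X]mulr_powRB1 ?addr_ge0// mulrDl lerD ?H//.
by rewrite addrC H.
Qed.

Lemma sum_powR_le p n (a : 'I_n -> R) : 1 <= p -> (forall i, 0 <= a i) ->
  \sum_i a i `^ p <= (\sum_i a i) `^ p.
Proof.
move=> p1; elim: n a => [|n IH] a a0; first by rewrite !big_ord0 powR_ge0.
rewrite !big_ord_recr/=; apply: le_trans (powRD_le p _ _ p1 _ _) => //.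
  by rewrite lerD2r IH.
by rewrite sumr_ge0.
Qed.

(** The truncations to consecutive bands are nondecreasing in [|u|] and add up to
    the truncation between the extreme levels, which is 1-Lipschitz. Hence the
    sum of the increments is at most [|u - v|], and so is their [l^p] norm since
    [p >= 1]. *)
Lemma sum_band_trunc_le p (t : nat -> R) n u v : 1 <= p ->
    (forall i, t i <= t i.+1) ->
  \sum_(i < n) `|band_trunc (t i) (t i.+1) u - band_trunc (t i) (t i.+1) v| `^ p
    <= `|u - v| `^ p.
Proof.
move=> p1 tS.
have p0 : 0 <= p by exact: le_trans p1.
have t0 m : t 0%N <= t m by elim: m => // m IH; exact: le_trans IH _.
have tele m w : \sum_(i < m) band_trunc (t i) (t i.+1) w = band_trunc (t 0%N) (t m) w.
  elim: m => [|m IH]; last by rewrite big_ord_recr/= IH band_truncD.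
  rewrite big_ord0 /band_trunc min_r ?subrr//.
  by rewrite le_max lexx orbT.
apply: le_trans (sum_powR_le p n (fun i => `|band_trunc (t i) (t i.+1) u - band_trunc (t i) (t i.+1) v|) p1 _) _.
  by [].
rewrite ge0_ler_powR ?nnegrE ?sumr_ge0//.
apply: le_trans (band_trunc_lipschitz (t 0%N) (t n) u v (t0 n)).
wlog vu : u v / `|v| <= `|u|.
  move=> H; have [/H//|/ltW/H] := leP `|v| `|u|.
  rewrite distrC; under eq_bigr do rewrite distrC; exact.
rewrite ger0_norm ?subr_ge0 ?band_trunc_le// -!tele -sumrB.
by apply: ler_sum => i _; rewrite ger0_norm// subr_ge0 band_trunc_le.
Qed.

End BandTruncation.

(** * Lower limits in the extended reals *)

Section LowerLimit.
Context {R : realType} {T : choiceType} {X : filteredType T}.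
Implicit Types (g h : X -> \bar R) (F : set_system X).

Lemma le_limf_einf g h F : (forall x, g x <= h x) -> limf_einf g F <= limf_einf h F.
Proof.
move=> gh; rewrite !limf_einfE; apply: ge_ereal_sup => _ [V FV <-].
apply: le_ereal_sup_tmp; exists (ereal_inf (h @` V)); first by exists V.
apply: le_ereal_inf_tmp => _ [x Vx <-]; apply: le_trans (gh x).
by apply: ereal_inf_lbound; exists x.
Qed.

Lemma limf_einf_ge0 g F : Filter F -> (forall x, 0 <= g x) -> 0 <= limf_einf g F.
Proof.
move=> FF g0; rewrite limf_einfE; apply: le_ereal_sup_tmp.
exists (ereal_inf (g @` setT)); first by exists setT => //; exact: filterT.
by apply: le_ereal_inf_tmp => _ [x _ <-].
Qed.

Lemma limf_einf_le_esup g F : ProperFilter F ->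
  limf_einf g F <= limf_esup g F.
Proof.
move=> FF; rewrite limf_einfE limf_esupE.
apply: ge_ereal_sup => _ [V FV <-]; apply: le_ereal_inf_tmp => _ [W FW <-].
have [x [Vx Wx]] := filter_ex (filterI FV FW).
apply: (@le_trans _ _ (g x)); first by apply: ereal_inf_lbound; exists x.
by apply: ereal_sup_ubound; exists x.
Qed.

Lemma limf_einf_superadditive g h F : Filter F ->
    (forall x, 0 <= g x) -> (forall x, 0 <= h x) ->
  limf_einf g F + limf_einf h F <= limf_einf (fun x => g x + h x) F.
Proof.
move=> FF g0 h0; rewrite !limf_einfE; apply: ereal_supD_le.
- by exists (ereal_inf (g @` setT)); exists setT => //; exact: filterT.
- by exists (ereal_inf (h @` setT)); exists setT => //; exact: filterT.
- by move=> _ [V _ <-]; apply: le_ereal_inf_tmp => _ [x _ <-].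
- by move=> _ [V _ <-]; apply: le_ereal_inf_tmp => _ [x _ <-].
move=> _ _ [V FV <-] [W FW <-]; apply: le_ereal_sup_tmp.
exists (ereal_inf ((fun x => g x + h x) @` (V `&` W))).
  by exists (V `&` W) => //; exact: filterI.
apply: le_ereal_inf_tmp => _ [x [Vx Wx] <-]; apply: leeD;
  by apply: ereal_inf_lbound; exists x.
Qed.

Lemma limf_einf_sum n (g : 'I_n -> X -> \bar R) F : Filter F ->
    (forall i x, 0 <= g i x) ->
  \sum_(i < n) limf_einf (g i) F <= limf_einf (fun x => \sum_(i < n) g i x) F.
Proof.
move=> FF; elim: n g => [|n IH] g g0.
  by rewrite big_ord0; apply: limf_einf_ge0 => x; rewrite big_ord0.
rewrite big_ord_recr/=.
apply: (@le_trans _ _ (limf_einf (fun x => \sum_(i < n) g (widen_ord (leqnSn n) i) x + g ord_max x) F)).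
  apply: le_trans (limf_einf_superadditive _ _ _ FF _ _) => //.
    by rewrite leeD2r// IH.
  by move=> x; rewrite sume_ge0.
by apply: le_limf_einf => x; rewrite big_ord_recr.
Qed.

Lemma limf_einf_le_poweR g F (p : R) : (0 < p)%R -> (forall x, 0 <= g x) ->
  limf_einf g F <= (limf_einf (fun x => g x `^ p^-1) F) `^ p.
Proof.
move=> p0 g0; rewrite !limf_einfE; apply: ge_ereal_sup => _ [V FV <-].
have V0 : 0 <= ereal_inf (g @` V) by apply: le_ereal_inf_tmp => _ [x _ <-].
have -> : ereal_inf (g @` V) = (ereal_inf (g @` V) `^ p^-1) `^ p.
  by rewrite -poweRrM mulVf ?gt_eqF// poweRe1.
have H : ereal_inf (g @` V) `^ p^-1 <=
    ereal_sup [set ereal_inf [set g x `^ p^-1 | x in V] | V in F].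
  apply: le_ereal_sup_tmp; exists (ereal_inf [set g x `^ p^-1 | x in V]); first by exists V.
  apply: le_ereal_inf_tmp => _ [x Vx <-].
  apply: gt0_ler_poweR; rewrite ?in_itv/= ?leey ?andbT ?invr_ge0 ?(ltW p0)//.
  by apply: ereal_inf_lbound; exists x.
apply: gt0_ler_poweR; rewrite ?in_itv/= ?leey ?andbT ?(ltW p0) ?poweR_ge0//.
exact: le_trans (poweR_ge0 _ _) H.
Qed.

Lemma le_limf_esup g h F : (forall x, g x <= h x) -> limf_esup g F <= limf_esup h F.
Proof.
move=> gh; rewrite !limf_esupE; apply: le_ereal_inf_tmp => _ [V FV <-].
apply: (@le_trans _ _ (ereal_sup (g @` V))).
  by apply: ereal_inf_lbound; exists V.
apply: ge_ereal_sup => _ [x Vx <-]; apply: le_trans (gh x) _.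
by apply: ereal_sup_ubound; exists x.
Qed.

End LowerLimit.

(** * Korevaar-Schoen energies of truncations *)

Section Energy.
Context {R : realType} {X : pmetricType R}.
Variable mu : {measure set (borel_type X) -> \bar R}.
Implicit Types (f g : borel_type X -> R) (p a r s t : R).

Lemma measurable_ball (x : X) r : measurable (ball x r : set (borel_type X)).
Proof.
apply: sub_sigma_algebra; rewrite openE => y.
rewrite /interior ballEmdist/= => xy.
have e0 : (0 < r - mdist x y)%R by rewrite subr_gt0.
apply/nbhs_ballP; exists (r - mdist x y)%R => //= z.
rewrite !ballEmdist/= ltrBrDl => H.
by apply: le_lt_trans H; exact: metric_triangle.
Qed.

Lemma positive_doubling_ball : positive_doubling mu ->
  forall (x : X) r, (0 < r)%R -> 0 < mu (ball x r) < +oo.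
Proof.
move=> [C C0 H] x r r0; apply/andP; split.
  have r20 : (0 < r / 2)%R by rewrite divr_gt0.
  by have [+ _ _] := H x _ r20; rewrite mulrC divfK.
have [_ _] := H x r r0.
have [->|] := eqVneq (mu (ball x r)) +oo; last by rewrite -ltey.
by rewrite gt0_muley ?lte_fin.
Qed.

Lemma KS_energy_ge0 p a f r : 0 <= KS_energy mu p a f r.
Proof.
apply: integral_ge0 => x _; rewrite mule_ge0 ?inve_ge0//.
by apply: integral_ge0 => y _; rewrite lee_fin divr_ge0 ?powR_ge0.
Qed.

(** Superadditivity of the lower integral, for the inner integral and then for the
    outer one. *)
Lemma sum_KS_energy_le p a f n (h : 'I_n -> borel_type X -> R) r :
    (forall x y, (\sum_(i < n) `|h i y - h i x| `^ p <= `|f y - f x| `^ p)%R) ->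
  \sum_(i < n) KS_energy mu p a (h i) r <= KS_energy mu p a f r.
Proof.
move=> hf; rewrite /KS_energy.
have I0 (g : borel_type X -> R) x : 0 <= \int[mu]_(y in ball (x : X) r) (`|g y - g x| `^ p / r `^ (p * a))%:E.
  by apply: integral_ge0 => y _; rewrite lee_fin divr_ge0 ?powR_ge0.
apply: le_trans (lower_integral_sum mu setT n _ _) _.
  by move=> i x _; rewrite mule_ge0 ?inve_ge0.
apply: ge0_le_lower_integral => x _.
  by rewrite sume_ge0// => i _; rewrite mule_ge0 ?inve_ge0.
rewrite -ge0_sume_distrr// lee_wpmul2l ?inve_ge0//.
apply: le_trans (lower_integral_sum mu _ n _ _) _.
  by move=> i y _; rewrite lee_fin divr_ge0 ?powR_ge0.
apply: ge0_le_lower_integral => y _.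
  by rewrite sume_ge0// => i _; rewrite lee_fin divr_ge0 ?powR_ge0.
by rewrite sumEFin lee_fin -mulr_suml ler_wpM2r ?invr_ge0 ?powR_ge0.
Qed.

Lemma le_KS_energy p a f h r :
    (forall x y, (`|h y - h x| `^ p <= `|f y - f x| `^ p)%R) ->
  KS_energy mu p a h r <= KS_energy mu p a f r.
Proof.
move=> hf; have := @sum_KS_energy_le p a f 1 (fun=> h) r.
by rewrite big_ord1; apply => x y; rewrite big_ord1.
Qed.

Lemma Lfun_pE p f : (0 < p)%R -> (f \in Lfun mu p%:E) <->
  measurable_fun setT f /\ \int[mu]_x (`|f x| `^ p)%:E < +oo.
Proof.
move=> p0.
have E : \int[mu]_x (`|f x| `^ p)%:E = 'N[mu]_p%:E[EFin \o f] `^ p.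
  by rewrite poweR_Lnorm ?gt_eqF.
split.
  move=> /andP[mf /[!inE] ff]; split; first by rewrite inE in mf.
  by rewrite E poweR_lty.
move=> [mf ff]; apply/andP; split; rewrite inE//= /finite_norm.
by apply: (lty_poweRy (r := p)); rewrite ?gt_eqF// -E.
Qed.

Lemma KS_space_band_trunc p a f s t : (1 <= p)%R -> (0 < s)%R -> (s <= t)%R ->
  KS_space mu p a f -> KS_space mu p a (band_trunc s t \o f).
Proof.
move=> p1 s0 st [fL fE].
have p0 : (0 < p)%R by exact: lt_le_trans p1.
have /Lfun_pE -/(_ p0) [mf fp] := fL.
split; last first.
  apply: le_lt_trans fE; apply: le_limf_esup => r; apply: le_KS_energy => x y.
  by rewrite ge0_ler_powR ?nnegrE ?(ltW p0)//= band_trunc_lipschitz.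
apply/Lfun_pE => //; split.
  apply: measurable_funB => //; apply: measurable_minr => //.
  apply: measurable_maxr => //; exact: measurableT_comp.
apply: le_lt_trans fp; apply: ge0_le_lower_integral => x _.
  by rewrite lee_fin powR_ge0.
rewrite lee_fin ge0_ler_powR ?nnegrE ?(ltW p0)//=.
have := band_trunc_lipschitz s t (f x) 0 st.
by rewrite band_trunc0// !subr0.
Qed.

(** An isoperimetric inequality: as [{|f| >= s}] has at most half of the measure
    of any ball of radius [r], at least half of the ball around each point of
    [{|f| >= t}] lies in [{|f| < s}], where the truncation differs by [t - s]
    from its value at the center. *)
Lemma KS_energy_band_trunc_ge p a f r s t (V : R) : measurable_fun setT f ->
    (0 < r)%R -> (0 < p)%R -> (s <= t)%R -> (0 < V)%R ->
    (forall x : X, V%:E <= mu (ball x r) < +oo) ->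
    mu (superlevel f s) <= (V / 2)%:E ->
  ((t - s) `^ p / (2 * r `^ (p * a)))%:E * mu (superlevel f t)
    <= KS_energy mu p a (band_trunc s t \o f) r.
Proof.
move=> mf r0 p0 st V0 HV fs.
have I0 (x : X) : 0 <= \int[mu]_(y in ball (x : X) r)
    (`|(band_trunc s t \o f) y - (band_trunc s t \o f) x| `^ p / r `^ (p * a))%:E.
  by apply: integral_ge0 => y _; rewrite lee_fin divr_ge0 ?powR_ge0.
apply: lower_integral_ge => //.
- exact: measurable_superlevel.
- by rewrite divr_ge0 ?mulr_ge0 ?powR_ge0.
- by move=> x _; rewrite mule_ge0 ?inve_ge0.
move=> x tx.
have /andP[Vm moo] := HV x.
have mfin : mu (ball (x : X) r) \is a fin_num by rewrite ge0_fin_numE.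
pose m := fine (mu (ball (x : X) r)).
have mE : mu (ball (x : X) r) = m%:E by rewrite fineK.
have m0 : (0 < m)%R by apply: lt_le_trans V0 _; rewrite -lee_fin -mE.
pose B : set (borel_type X) := ball (x : X) r `\` superlevel f s.
have mB : measurable B.
  by apply: measurableD; [exact: measurable_ball|exact: measurable_superlevel].
have HB : (m / 2)%:E <= mu B.
  have H : mu (ball (x : X) r) <= mu B + mu (superlevel f s).
    apply: le_trans (measureU2 mu mB (measurable_superlevel f s mf)).
    apply: le_measure; rewrite ?inE.
    - exact: measurable_ball.
    - by apply: measurableU => //; exact: measurable_superlevel.
    - by move=> y By; have [|] := pselect (superlevel f s y); [right|left].
  have : m%:E <= mu B + (m / 2)%:E.
    rewrite -mE; apply: le_trans H _; rewrite leeD2l//; apply: le_trans fs _.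
    by rewrite lee_fin ler_pM2r ?invr_gt0// -lee_fin -mE.
  by rewrite -leeBlDr// -EFinB {1}(splitr m) addrK.
have : ((t - s) `^ p / r `^ (p * a))%:E * mu B <=
    \int[mu]_(y in ball (x : X) r)
    (`|(band_trunc s t \o f) y - (band_trunc s t \o f) x| `^ p / r `^ (p * a))%:E.
  apply: lower_integral_ge => //.
  - exact: measurable_ball.
  - by move=> y [].
  - by rewrite divr_ge0 ?powR_ge0.
  - by move=> y _; rewrite lee_fin divr_ge0 ?powR_ge0.
  move=> y [_ /negP]; rewrite -ltNge => ys.
  rewrite lee_fin /= (band_trunc_top s t (f x))// (band_trunc_bottom s t (f y)) ?(ltW ys)//.
  by rewrite sub0r normrN ger0_norm ?subr_ge0.
rewrite mE inver gt_eqF// => H.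
apply: (@le_trans _ _ (m^-1%:E * (((t - s) `^ p / r `^ (p * a))%:E * mu B))); last first.
  by rewrite lee_wpmul2l// lee_fin invr_ge0 ltW.
apply: (@le_trans _ _ (m^-1%:E * (((t - s) `^ p / r `^ (p * a))%:E * (m / 2)%:E))).
  rewrite -!EFinM lee_fin le_eqVlt; apply/orP; left; apply/eqP; field.
  by rewrite !gt_eqF ?powR_gt0.
rewrite lee_wpmul2l ?lee_fin ?invr_ge0 ?(ltW m0)// lee_wpmul2l//.
by rewrite lee_fin divr_ge0 ?powR_ge0.
Qed.

End Energy.

(** * The critical exponent *)

Section CriticalExponent.
Context {R : realType} {X : pmetricType R}.
Variable mu : {measure set (borel_type X) -> \bar R}.
Implicit Types (f g : borel_type X -> R) (p a b r s t : R).

Lemma ereal_between (x y : \bar R) : x < y -> exists r : R, x < r%:E < y.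
Proof.
case: x y => [x| |] [y| |]//=.
- by rewrite lte_fin => xy; exists ((x + y) / 2)%R; rewrite !lte_fin; apply/andP; split; lra.
- by move=> _; exists (x + 1)%R; rewrite lte_fin ltrDl ltr01 ltry.
- by move=> _; exists (y - 1)%R; rewrite ltNyr lte_fin gtrBl ltr01.
- by move=> _; exists 0%R; rewrite ltNyr ltry.
Qed.

Lemma ball_exhaust (A : set (borel_type X)) : measurable A -> 0 < mu A ->
  exists n0, forall n, (n0 <= n)%N -> 0 < mu (A `&` ball (point : X) n.+1%:R).
Proof.
move=> mA A0.
have [[n0 Hn0]|H] := pselect (exists n, 0 < mu (A `&` ball (point : X) n.+1%:R)).
  exists n0 => n nn; apply: lt_le_trans Hn0 _; apply: le_measure; rewrite ?inE.
  - by apply: measurableI => //; exact: measurable_ball.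
  - by apply: measurableI => //; exact: measurable_ball.
  - by apply: setIS; apply: le_ball; rewrite ler_nat.
exfalso; have : mu.-negligible A.
  have AU : A `<=` \bigcup_n (A `&` ball (point : X) n.+1%:R).
    move=> x Ax; exists (Num.trunc (mdist (point : X) x)) => //; split => //.
    by rewrite ballEmdist/= truncnS_gt.
  apply: (negligibleS AU); apply: negligible_bigcup => n; exists (A `&` ball (point : X) n.+1%:R); split => //.
    by apply: measurableI => //; exact: measurable_ball.
  apply/eqP; rewrite eq_le measure_ge0 andbT leNgt; apply/negP => H'.
  by apply: H; exists n.
move=> /(negligibleP _ mA) A00.
by move: A0; rewrite A00 ltxx.
Qed.

(** Inside a large ball of radius [N], the sets [{f < s}] and [{f > t}] both have
    positive measure, and every ball of radius [2 N] centered at a point of the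
    second one contains the part of the first one. *)
Lemma KS_energy_gt0 p a f s t : positive_doubling mu -> (0 < p)%R ->
    measurable_fun setT f -> (s < t)%R ->
    0 < mu [set x | (f x < s)%R] -> 0 < mu [set x | (t < f x)%R] ->
  exists2 r, (0 < r)%R & 0 < KS_energy mu p a f r.
Proof.
move=> dbl p0 mf st; set D := [set x | (f x < s)%R]; set A := [set x | (t < f x)%R].
move=> D0 A0.
have mD : measurable D.
  rewrite -[X in measurable X]setTI.
  have -> : D = f @^-1` `]-oo, s[ by apply/seteqP; split => x; rewrite /D/= in_itv.
  by apply: mf => //; exact: measurable_itv.
have mA : measurable A.
  rewrite -[X in measurable X]setTI.
  have -> : A = f @^-1` `]t, +oo[.
    by apply/seteqP; split => x; rewrite /A/= in_itv/= andbT.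
  by apply: mf => //; exact: measurable_itv.
have [n1 H1] := ball_exhaust D mD D0.
have [n2 H2] := ball_exhaust A mA A0.
pose n := maxn n1 n2; pose N : R := n.+1%:R.
have N0 : (0 < N)%R by rewrite ltr0n.
pose D' : set (borel_type X) := D `&` ball (point : X) N.
pose A' : set (borel_type X) := A `&` ball (point : X) N.
have mD' : measurable D' by apply: measurableI => //; exact: measurable_ball.
have mA' : measurable A' by apply: measurableI => //; exact: measurable_ball.
have D'0 : 0 < mu D' by apply: H1; rewrite leq_maxl.
have A'0 : 0 < mu A' by apply: H2; rewrite leq_maxr.
exists (2 * N)%R; first by rewrite mulr_gt0.
have W0 := positive_doubling_ball mu dbl (point : X) (3 * N)%R.
have /andP[{}W0 Woo] := W0 ltac:(by rewrite mulr_gt0).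
have Wfin : mu (ball (point : X) (3 * N)%R) \is a fin_num by rewrite ge0_fin_numE.
pose W := fine (mu (ball (point : X) (3 * N)%R)).
have WE : mu (ball (point : X) (3 * N)%R) = W%:E by rewrite fineK.
have {}W0 : (0 < W)%R by rewrite -lte_fin -WE.
have D'fin : mu D' \is a fin_num.
  rewrite ge0_fin_numE//; apply: le_lt_trans Woo; apply: le_measure; rewrite ?inE//.
    exact: measurable_ball.
  move=> y [_]; apply: le_ball; rewrite ler_peMl ?(ltW N0)//.
  by rewrite ler1n.
pose k := ((t - s) `^ p / (2 * N) `^ (p * a) * fine (mu D'))%R.
have k0 : (0 < k)%R.
  rewrite !mulr_gt0 ?invr_gt0 ?powR_gt0 ?subr_gt0 ?mulr_gt0//.
  by rewrite fine_gt0// D'0 -ge0_fin_numE.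
apply: (@lt_le_trans _ _ ((W^-1 * k)%:E * mu A')).
  by rewrite mule_gt0// lte_fin mulr_gt0 ?invr_gt0.
have I0 (x : X) : 0 <= \int[mu]_(y in ball (x : X) (2 * N)%R)
    (`|f y - f x| `^ p / (2 * N) `^ (p * a))%:E.
  by apply: integral_ge0 => y _; rewrite lee_fin divr_ge0 ?powR_ge0.
apply: lower_integral_ge => //.
- by rewrite mulr_ge0 ?invr_ge0 ?(ltW W0) ?(ltW k0).
- by move=> x _; rewrite mule_ge0 ?inve_ge0.
move=> x [Ax xN].
have /andP[m0 moo] := positive_doubling_ball mu dbl (x : X) (2 * N)%R ltac:(by rewrite mulr_gt0).
have mfin : mu (ball (x : X) (2 * N)%R) \is a fin_num by rewrite ge0_fin_numE.
have mW : mu (ball (x : X) (2 * N)%R) <= W%:E.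
  rewrite -WE; apply: le_measure; rewrite ?inE; [exact: measurable_ball|exact: measurable_ball|].
  move=> y xy; have -> : (3 * N = N + 2 * N)%R by ring.
  exact: ball_triangle xN xy.
have D'sub : D' `<=` ball (x : X) (2 * N)%R.
  move=> y [_ yN]; have -> : (2 * N = N + N)%R by ring.
  apply: ball_triangle yN; exact: ball_sym.
have H : k%:E <= \int[mu]_(y in ball (x : X) (2 * N)%R)
    (`|f y - f x| `^ p / (2 * N) `^ (p * a))%:E.
  rewrite /k EFinM fineK//; apply: lower_integral_ge => //.
  - exact: measurable_ball.
  - by rewrite divr_ge0 ?powR_ge0.
  - by move=> y _; rewrite lee_fin divr_ge0 ?powR_ge0.
  move=> y [Dy _]; rewrite lee_fin ler_wpM2r ?invr_ge0 ?powR_ge0//.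
  rewrite ge0_ler_powR ?nnegrE ?subr_ge0 ?(ltW p0) ?(ltW st)//.
  rewrite distrC; apply: le_trans (ler_norm _).
  by rewrite lerB// ltW.
move: m0 mW mfin; case: (mu (ball (x : X) (2 * N)%R)) => // m; rewrite lte_fin lee_fin => m0 mW _.
rewrite inver gt_eqF// EFinM; apply: lee_pmul => //.
- by rewrite lee_fin invr_ge0 ltW.
- by rewrite lee_fin ltW.
- by rewrite lee_fin lef_pV2.
Qed.

Lemma ae_constant_KS_energy_eq0 p a f : positive_doubling mu -> (0 < p)%R ->
    measurable_fun setT f -> (forall r, (0 < r)%R -> KS_energy mu p a f r = 0) ->
  ae_constant mu f.
Proof.
move=> dbl p0 mf E0.
have muX : 0 < mu [set: borel_type X].
  have /andP[H _] := positive_doubling_ball mu dbl (point : X) 1%R ltr01.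
  apply: lt_le_trans H _; apply: le_measure; rewrite ?inE//; exact: measurable_ball.
pose F : borel_type X -> \bar R := EFin \o f.
have proper := ae_properfilter_algebraOfSetsType muX.
have [Mm|mM] := leP (ess_sup mu F) (ess_inf mu F).
  have HM := ess_sup_ge mu F.
  have Hm := ess_inf_le mu F.
  have HE : {ae mu, forall x, F x = ess_sup mu F}.
    apply: filterS2 HM Hm => x H1 H2; apply/eqP; rewrite eq_le H1/=.
    exact: le_trans Mm H2.
  have [x0 Hx0] := filter_ex HE.
  exists (f x0); apply: filterS HE => x; rewrite -Hx0.
  by move=> [].
exfalso.
have [s [t [ms st tM]]] : exists s t : R, [/\ ess_inf mu F < s%:E, (s < t)%R & t%:E < ess_sup mu F].
  have [s /andP[ms sM]] := ereal_between _ _ mM.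
  have [t /andP[st tM]] := ereal_between _ _ sM.
  by exists s, t; split => //; rewrite -lte_fin.
have negl (P : set (borel_type X)) : measurable P -> mu P = 0 -> {ae mu, forall x, ~ P x}.
  by move=> mP P0; exists P; split => // x /= /contrapT.
have [||r r0] := KS_energy_gt0 p a f s t dbl p0 mf st.
- rewrite lt_neqAle measure_ge0 andbT eq_sym; apply/eqP => H.
  move: ms; rewrite ltNge => /negP; apply; apply/ess_infP.
  apply: filterS (negl _ _ H) => [x /= /negP|]; first by rewrite -leNgt lee_fin.
  rewrite -[X in measurable X]setTI (_ : [set x | _] = f @^-1` `]-oo, s[).
    by apply: mf => //; exact: measurable_itv.
  by apply/seteqP; split => x; rewrite /= in_itv.
- rewrite lt_neqAle measure_ge0 andbT eq_sym; apply/eqP => H.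
  move: tM; rewrite ltNge => /negP; apply; apply/ess_supP.
  apply: filterS (negl _ _ H) => [x /= /negP|]; first by rewrite -leNgt lee_fin.
  rewrite -[X in measurable X]setTI (_ : [set x | _] = f @^-1` `]t, +oo[).
    by apply: mf => //; exact: measurable_itv.
  by apply/seteqP; split => x; rewrite /= in_itv/= andbT.
by rewrite E0// ltxx.
Qed.

(** A function of [besov_space p b] with [b > a] has
    [KS_energy p a f r <= r ^ (p (b - a)) * M], which tends to 0 with [r];
    [property_P p a] then makes all its energies vanish, so that it is constant. *)
Lemma crit_exponentE p a : positive_doubling mu -> (1 <= p)%R -> (0 <= a)%R ->
  property_P mu p a -> crit_exponent mu p = a%:E.
Proof.
move=> dbl p1 a0 [[f fKS fnc] [C C1 HC]].
have p0 : (0 < p)%R by exact: lt_le_trans p1.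
apply/eqP; rewrite eq_le; apply/andP; split; last first.
  apply: ereal_sup_ubound; exists a => //; split => //; exists f => //.
  have [fL fE] := fKS; split => //; apply: le_lt_trans (HC f fKS) _.
  have liminf_lty : limf_einf (KS_energy mu p a f) 0^'+ < +oo.
    by apply: le_lt_trans fE; exact: limf_einf_le_esup.
  by apply: lte_mul_pinfty => //; rewrite lee_fin (le_trans _ C1).
apply: ge_ereal_sup => _ [b [b0 [g [gL gE] gnc]] <-]; rewrite lee_fin leNgt.
apply/negP => ab; apply: gnc.
have /(Lfun_pE mu p g p0)[mg gp] := gL.
set M := ereal_sup _ in gE.
have M0 : 0 <= M.
  by apply: le_trans (KS_energy_ge0 mu p b g 1) _; apply: ereal_sup_ubound; exists 1%R => //=; exact: ltr01.
have Mfin : M \is a fin_num by rewrite ge0_fin_numE.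
pose e := (p * (b - a))%R.
have e0 : (0 < e)%R by rewrite mulr_gt0 ?subr_gt0.
have scale r : (0 < r)%R -> KS_energy mu p a g r <= (r `^ e * fine M)%:E.
  move=> r0.
  have : (r `^ (- e))%:E * KS_energy mu p a g r <= M.
    apply: (@le_trans _ _ (KS_energy mu p b g r)); last first.
      by apply: ereal_sup_ubound; exists r.
    have I0 (x : X) (q : R) : 0 <= \int[mu]_(y in ball (x : X) r) (`|g y - g x| `^ p / r `^ q)%:E.
      by apply: integral_ge0 => y _; rewrite lee_fin divr_ge0 ?powR_ge0.
    apply: le_trans (lower_integralZl_le mu setT _ _ (powR_ge0 _ _) _) _.
      by move=> x _; rewrite mule_ge0 ?inve_ge0.
    apply: ge0_le_lower_integral => x _.
      by rewrite !mule_ge0 ?inve_ge0// lee_fin powR_ge0.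
    rewrite muleCA lee_wpmul2l ?inve_ge0//.
    apply: le_trans (lower_integralZl_le mu _ _ _ (powR_ge0 _ _) _) _.
      by move=> y _; rewrite lee_fin divr_ge0 ?powR_ge0.
    apply: ge0_le_lower_integral => y _.
      by rewrite mule_ge0// lee_fin ?divr_ge0 ?powR_ge0.
    rewrite -EFinM lee_fin mulrCA ler_wpM2l ?powR_ge0// -!powRN -powRD_gt0//.
    by rewrite /e le_eqVlt; apply/orP; left; apply/eqP; congr (_ `^ _)%R; ring.
  rewrite powRN -[M]fineK// muleC -lee_pdivlMr ?invr_gt0 ?powR_gt0// => /le_trans; apply.
  by rewrite invrK mulrC -EFinM.
have lim0 : limf_esup (KS_energy mu p a g) 0^'+ <= 0.
  apply/lee_addgt0Pr => eps eps0; rewrite add0e limf_esupE.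
  pose dl := ((eps / (fine M + 1)) `^ e^-1)%R.
  have M1 : (0 < fine M + 1)%R by rewrite ltr_wpDl// fine_ge0.
  have dl0 : (0 < dl)%R by rewrite powR_gt0// divr_gt0.
  apply: (@le_trans _ _ (ereal_sup (KS_energy mu p a g @` `]0%R, dl[))).
    apply: ereal_inf_lbound; exists `]0%R, dl[%classic => //.
    have H1 : \forall z \near (0%R : R)^'+, (0 < z)%R by exact: nbhs_right_gt.
    have H2 : \forall z \near (0%R : R)^'+, (z < dl)%R by exact: nbhs_right_lt.
    by apply: filterS (filterI H1 H2) => z [z0 zd] /=; rewrite in_itv/= z0.
  apply: ge_ereal_sup => _ [r /= + <-]; rewrite in_itv/= => /andP[r0 rd].
  apply: le_trans (scale r r0) _; rewrite lee_fin.
  apply: (@le_trans _ _ (dl `^ e * (fine M + 1))%R).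
    rewrite ler_pM ?powR_ge0 ?fine_ge0 ?lerDl//.
    by rewrite ge0_ler_powR ?nnegrE ?(ltW e0) ?(ltW r0) ?(ltW dl0) ?(ltW rd).
  by rewrite /dl -powRrM mulVf ?gt_eqF// powRr1 ?divr_ge0 ?(ltW M1) ?(ltW eps0)// divfK ?gt_eqF.
have gKS : KS_space mu p a g by split => //; exact: le_lt_trans lim0 _.
apply: (ae_constant_KS_energy_eq0 p a) => // r r0.
apply/eqP; rewrite eq_le KS_energy_ge0 andbT.
apply: (@le_trans _ _ (ereal_sup [set KS_energy mu p a g r | r in [set r : R | (0 < r)%R]])).
  by apply: ereal_sup_ubound; exists r.
apply: le_trans (HC g gKS) _; rewrite mule_ge0_le0 ?lee_fin ?(le_trans _ C1)//.
by apply: le_trans lim0; exact: limf_einf_le_esup.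
Qed.

End CriticalExponent.

(** * Decay of superlevel sets in terms of the variation *)

Section SuperlevelDecay.
Context {R : realType} {X : pmetricType R}.
Variable mu : {measure set (borel_type X) -> \bar R}.
Implicit Types (f g : borel_type X -> R) (p a b r s t Q : R).

Lemma volume_lower_bound Q : positive_doubling mu -> volume_growth mu Q ->
    (exists2 R0 : R, (0 < R0)%R & 0 < ereal_inf [set mu (ball x R0) | x in [set: X]]) ->
  exists c R0 : R, [/\ (0 < c)%R, (0 < R0)%R &
    forall (x : X) r, (0 < r)%R -> (r <= R0)%R -> (c * r `^ Q)%:E <= mu (ball x r)].
Proof.
move=> dbl [C C0 grow] [R0 R00 inf0].
have ball_fin (x : X) r : (0 < r)%R -> exists2 m : R, (0 < m)%R & mu (ball x r) = m%:E.
  move=> r0; have /andP[] := positive_doubling_ball mu dbl x r r0.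
  by case: (mu (ball x r)) => // m; rewrite lte_fin => ? _; exists m.
have [m m0 Hm] : exists2 m : R, (0 < m)%R & forall x : X, m%:E <= mu (ball x R0).
  have := inf0; have inf_le (x : X) : ereal_inf [set mu (ball x R0) | x in [set: X]] <= mu (ball x R0).
    by apply: ereal_inf_lbound; exists x.
  move: inf_le; case: ereal_inf => //= [m Hm|Hoo _].
    by rewrite lte_fin; exists m.
  have [m _ mE] := ball_fin point R0 R00.
  by have := Hoo point; rewrite mE leye_eq.
have R0Q : (0 < R0 `^ Q)%R by rewrite powR_gt0.
exists (m / (C * R0 `^ Q))%R, R0; split => //; first by rewrite divr_gt0// mulr_gt0.
move=> x r r0 rR0; have := grow x r R0 r0 rR0.
have [mr mr0 ->] := ball_fin x r r0.
have := Hm x; have [mR mR0 ->] := ball_fin x R0 R00.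
rewrite inver gt_eqF// -EFinM !lee_fin => mmR H.
have rQ : (0 < r `^ Q)%R by rewrite powR_gt0.
rewrite powRM ?invr_ge0 ?(ltW r0) ?(ltW R00)// in H.
have rV : (r^-1 `^ Q = (r `^ Q)^-1)%R.
  by rewrite -powR_inv1 ?(ltW r0)// -powRrM mulN1r powRN.
rewrite rV ler_pdivrMr// in H.
rewrite -mulrA mulrC; apply: (@le_trans _ _ (mR / (C * R0 `^ Q) * r `^ Q)%R).
  rewrite -mulrA mulrC; rewrite ler_wpM2r ?mulr_ge0 ?invr_ge0 ?(ltW rQ) ?mulr_ge0 ?(ltW C0) ?(ltW R0Q)//.
rewrite -ler_pdivlMr// ler_pdivrMr ?mulr_gt0//; apply: le_trans H _.
by rewrite le_eqVlt; apply/orP; left; apply/eqP; field; rewrite gt_eqF.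
Qed.

(** The energies of the bands may be taken at unrelated radii: each of them is
    bounded by a lower limit at 0, and lower limits are superadditive. *)
Lemma sum_band_energy_le p a f n (t : nat -> R) (r : 'I_n -> R) C :
    (1 <= p)%R -> (0 <= C)%R ->
    (forall f, KS_space mu p a f ->
      ereal_sup [set KS_energy mu p a f r | r in [set r : R | (0 < r)%R]]
      <= C%:E * limf_einf (KS_energy mu p a f) 0^'+) ->
    KS_space mu p a f -> (0 < t 0%N)%R -> (forall i, (t i <= t i.+1)%R) ->
    (forall i, (0 < r i)%R) ->
  \sum_(i < n) KS_energy mu p a (band_trunc (t i) (t i.+1) \o f) (r i)
    <= C%:E * limf_einf (KS_energy mu p a f) 0^'+.
Proof.
move=> p1 C0 HC fKS t0 tS r0.
have ti i : (0 < t i)%R by elim: i => // i IH; exact: lt_le_trans IH _.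
pose h (i : 'I_n) := band_trunc (t i) (t i.+1) \o f.
have hKS i : KS_space mu p a (h i) by exact: KS_space_band_trunc.
apply: (@le_trans _ _ (\sum_(i < n) C%:E * limf_einf (KS_energy mu p a (h i)) 0^'+)).
  apply: lee_sum => i _; apply: le_trans (HC (h i) (hKS i)).
  by apply: ereal_sup_ubound; exists (r i) => //=; exact: r0.
have lim0 i : 0 <= limf_einf (KS_energy mu p a (h i)) 0^'+.
  by apply: limf_einf_ge0 => x; exact: KS_energy_ge0.
rewrite -ge0_sume_distrr//; rewrite lee_wpmul2l ?lee_fin//.
apply: le_trans (limf_einf_sum _ _ _ _ _) _.
  by move=> i x; exact: KS_energy_ge0.
apply: le_limf_einf => x; apply: sum_KS_energy_le => y z.
by rewrite /h/=; exact: sum_band_trunc_le.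
Qed.

(** For the band starting at a level of mass [N], the radius with
    [c * r ^ Q = 2 N] makes all balls of radius [r] at least twice as large
    as the superlevel set, and the energy at this radius controls the band, the factor
    [r ^ (p a)] being a multiple of [N ^ (a p / Q)]. For [N > n0] this radius
    exceeds [R0], and the volume of balls need not grow beyond; but then
    [N ^ (a p / Q)] is bounded below and the band is controlled by its own
    contribution to the [p]-th moment. *)
Lemma band_bound_level_mass p a Q :
    (1 <= p)%R -> (0 < a)%R -> (0 < Q)%R ->
    positive_doubling mu -> volume_growth mu Q ->
    (exists2 R0 : R, (0 < R0)%R & 0 < ereal_inf [set mu (ball x R0) | x in [set: X]]) ->
    property_P mu p a ->
  exists2 C : R, (0 < C)%R & forall f, KS_space mu p a f ->
    forall A : R, (0 <= A)%R ->
      'N[mu]_(p%:E)[EFin \o f] + p_variation mu p f <= A%:E ->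
    band_bound p (a * p / Q) (C * A `^ p) (level_mass mu f).
Proof.
move=> p1 a0 Q0 dbl grow ncol PP.
have p0 : (0 < p)%R by exact: lt_le_trans p1.
have critE := crit_exponentE mu p a dbl p1 (ltW a0) PP.
have [_ [C' C'1 HC']] := PP.
have C'0 : (0 < C')%R by exact: lt_le_trans C'1.
have [c [R0 [c0 R00 vol]]] := volume_lower_bound Q dbl grow ncol.
set ga := (a * p / Q)%R.
have ga0 : (0 < ga)%R by rewrite divr_gt0 ?mulr_gt0.
pose n0 := (c * R0 `^ Q / 2)%R.
have n00 : (0 < n0)%R by rewrite divr_gt0 ?mulr_gt0 ?powR_gt0.
pose C1 := (2 * (2 / c) `^ ga + n0 `^ (- ga))%R.
have C10 : (0 < C1)%R by rewrite addr_gt0 ?powR_gt0// mulr_gt0// powR_gt0// divr_gt0.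
exists (C1 * (C' + 1))%R; first by rewrite mulr_gt0// addr_gt0.
move=> f fKS A A0 NVA t n t0 tS.
have [/(Lfun_pE mu p f p0)[mf fp] _] := fKS.
have ti i : (0 < t i)%R by elim: i => // i IH; exact: lt_le_trans IH _.
have N0 : 0 <= 'N[mu]_(p%:E)[EFin \o f] by exact: Lnorm_ge0.
have V0 : 0 <= p_variation mu p f.
  by apply: limf_einf_ge0 => r; exact: poweR_ge0.
have NA : \int[mu]_x (`|f x| `^ p)%:E <= (A `^ p)%:E.
  have -> : \int[mu]_x (`|f x| `^ p)%:E = 'N[mu]_p%:E[EFin \o f] `^ p.
    by rewrite poweR_Lnorm ?gt_eqF.
  rewrite -poweR_EFin; apply: gt0_ler_poweR; rewrite ?in_itv/= ?leey ?andbT ?lee_fin ?(ltW p0)//.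
  by apply: le_trans NVA; rewrite leeDl.
have VA : limf_einf (KS_energy mu p a f) 0^'+ <= (A `^ p)%:E.
  apply: le_trans (limf_einf_le_poweR _ _ p p0 _) _; first by move=> x; exact: KS_energy_ge0.
  have -> : limf_einf (fun r => KS_energy mu p a f r `^ p^-1) 0^'+ = p_variation mu p f.
    by rewrite /p_variation critE.
  rewrite -poweR_EFin; apply: gt0_ler_poweR; rewrite ?in_itv/= ?leey ?andbT ?lee_fin ?(ltW p0)//.
  by apply: le_trans NVA; rewrite leeDr.
have ffin s : (0 < s)%R -> mu (superlevel f s) < +oo.
  by move=> s0; exact: superlevel_lty mf s0 p0 fp.
have muE s : (0 < s)%R -> mu (superlevel f s) = (level_mass mu f s)%:E.
  by move=> s0; rewrite /level_mass fineK// ge0_fin_numE ?ffin.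
pose N i := level_mass mu f (t i).
(* the default 1 is for levels of mass 0 or more than n0, where any radius does *)
pose r (i : 'I_n) := if (0 < N i <= n0)%R then ((2 * N i / c) `^ Q^-1)%R else 1%R.
have r0 i : (0 < r i)%R.
  rewrite /r; case: ifPn => // /andP[Ni _].
  by rewrite powR_gt0 ?divr_gt0 ?mulr_gt0.
pose h (i : 'I_n) := band_trunc (t i) (t i.+1) \o f.
have sumE : \sum_(i < n) KS_energy mu p a (h i) (r i) <= (C' * A `^ p)%:E.
  apply: le_trans (sum_band_energy_le p a f n t r C' p1 (ltW C'0) HC' fKS t0 tS r0) _.
  by rewrite EFinM lee_wpmul2l ?lee_fin ?(ltW C'0).
have sumJ : \sum_(i < n) \int[mu]_x (`|h i x| `^ p)%:E <= (A `^ p)%:E.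
  apply: le_trans NA; apply: le_trans (lower_integral_sum _ _ _ _ _) _.
    by move=> i x _; rewrite lee_fin powR_ge0.
  apply: ge0_le_lower_integral => x _.
    by apply: sume_ge0 => i _; rewrite lee_fin powR_ge0.
  rewrite sumEFin lee_fin.
  have := sum_band_trunc_le p t n (f x) 0 p1 tS; rewrite subr0.
  by under eq_bigr do rewrite (band_trunc0 _ _ (ti _) (tS _)) subr0.
have term (i : 'I_n) : ((t i.+1 - t i) `^ p * N i.+1 * N i `^ (- ga))%:E <=
    C1%:E * (KS_energy mu p a (h i) (r i) + \int[mu]_x (`|h i x| `^ p)%:E).
  have EJ0 : 0 <= \int[mu]_x (`|h i x| `^ p)%:E.
    by apply: integral_ge0 => x _; rewrite lee_fin powR_ge0.
  have E0 := KS_energy_ge0 mu p a (h i) (r i).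
  have dp0 : (0 <= (t i.+1 - t i) `^ p)%R by exact: powR_ge0.
  have N'0 : (0 <= N i.+1)%R by exact: level_mass_ge0.
  have [Ni0|Ni] := eqVneq (N i) 0%R.
    rewrite Ni0 powR0 ?mulr0 ?oppr_eq0 ?gt_eqF//.
    by apply: mule_ge0; [rewrite lee_fin ltW|exact: adde_ge0].
  have {}Ni : (0 < N i)%R by rewrite lt_def Ni level_mass_ge0.
  have [Nn|nN] := leP (N i) n0.
    have rE : r i = ((2 * N i / c) `^ Q^-1)%R by rewrite /r Ni Nn.
    have rQ : (r i `^ Q = 2 * N i / c)%R.
      by rewrite rE -powRrM mulVf ?gt_eqF// powRr1// divr_ge0 ?mulr_ge0 ?(ltW Ni) ?(ltW c0).
    have rR0 : (r i <= R0)%R.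
      have -> : R0 = ((R0 `^ Q) `^ Q^-1)%R by rewrite -powRrM mulfV ?gt_eqF// powRr1// ltW.
      rewrite rE ge0_ler_powR ?nnegrE ?invr_ge0 ?powR_ge0 ?(ltW Q0)//.
        by rewrite divr_ge0 ?mulr_ge0 ?(ltW Ni) ?(ltW c0).
      rewrite ler_pdivrMr// -ler_pdivlMl//; apply: le_trans Nn _.
      by rewrite /n0 le_eqVlt; apply/orP; left; apply/eqP; field.
    have V0' : (0 < 2 * N i)%R by rewrite mulr_gt0.
    have HV (x : X) : (2 * N i)%:E <= mu (ball x (r i)) < +oo.
      have /andP[_ ->] := positive_doubling_ball mu dbl x (r i) (r0 i).
      rewrite andbT; apply: le_trans (vol x (r i) (r0 i) rR0).
      by rewrite rQ lee_fin [(c * _)%R]mulrC divfK ?gt_eqF.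
    have HN : mu (superlevel f (t i)) <= (2 * N i / 2)%:E.
      by rewrite muE// lee_fin /N mulrC mulKf.
    have H := KS_energy_band_trunc_ge mu p a f (r i) (t i) (t i.+1) (2 * N i)
      mf (r0 i) p0 (tS i) V0' HV HN.
    have raE : (r i `^ (p * a) = (2 / c) `^ ga * N i `^ ga)%R.
      rewrite -powRM ?divr_ge0 ?(ltW c0) ?(ltW Ni)//.
      have -> : (2 / c * N i = r i `^ Q)%R by rewrite rQ; field; rewrite gt_eqF.
      by rewrite -powRrM /ga; congr (_ `^ _)%R; field; rewrite gt_eqF.
    rewrite muE// -/(N i.+1) -EFinM in H.
    have c2 : (0 < (2 / c) `^ ga)%R by rewrite powR_gt0 ?divr_gt0.
    have Nga : (0 < N i `^ ga)%R by rewrite powR_gt0.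
    apply: (@le_trans _ _ ((2 * (2 / c) `^ ga)%:E *
        ((t i.+1 - t i) `^ p / (2 * r i `^ (p * a)) * N i.+1)%:E)).
      rewrite -EFinM lee_fin le_eqVlt; apply/orP; left; apply/eqP.
      by rewrite raE powRN; field; rewrite !gt_eqF.
    apply: lee_pmul; rewrite ?lee_fin ?mulr_ge0 ?powR_ge0 ?invr_ge0 ?mulr_ge0 ?powR_ge0//.
      by rewrite lerDl powR_ge0.
    by apply: le_trans H _; rewrite leeDl.
  have J : ((t i.+1 - t i) `^ p)%:E * mu (superlevel f (t i.+1)) <= \int[mu]_x (`|h i x| `^ p)%:E.
    apply: lower_integral_ge => //.
    - exact: measurable_superlevel.
    move=> x tx; rewrite lee_fin /h/= band_trunc_top ?tS//.
    by rewrite ger0_norm ?subr_ge0.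
  rewrite muE// -/(N i.+1) -EFinM in J.
  rewrite EFinM muleC; apply: lee_pmul; rewrite ?lee_fin ?powR_ge0 ?mulr_ge0//.
    apply: (@le_trans _ _ (n0 `^ (- ga))%R); last first.
      by rewrite lerDr mulr_ge0 ?powR_ge0.
    rewrite !powRN lef_pV2 ?posrE ?powR_gt0// ge0_ler_powR ?nnegrE ?(ltW ga0) ?(ltW n00) ?(ltW Ni) ?(ltW nN)//.
  by apply: le_trans J _; rewrite leeDr.
rewrite -lee_fin -sumEFin.
apply: le_trans; first by apply: lee_sum => i _; exact: term.
have E0 i : 0 <= KS_energy mu p a (h i) (r i) by exact: KS_energy_ge0.
have J0 i : 0 <= \int[mu]_x (`|h i x| `^ p)%:E.
  by apply: integral_ge0 => x _; rewrite lee_fin powR_ge0.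
rewrite -ge0_sume_distrr => [|i _]; last by rewrite adde_ge0.
rewrite big_split/= -mulrA EFinM lee_wpmul2l ?lee_fin ?(ltW C10)//.
by rewrite mulrDl mul1r EFinD leeD.
Qed.

End SuperlevelDecay.

(** * Interpolation inequalities from the decay of superlevel sets *)

Section NormsFromDecay.
Context {d : measure_display} {T : measurableType d} {R : realType}.
Variable mu : {measure set T -> \bar R}.
Implicit Types (f : T -> R) (p g r s th t A C M : R).

Lemma Lnorm_infty_le f M : measurable_fun setT f -> (0 <= M)%R ->
    (forall t, (M < t)%R -> mu (superlevel f t) = 0) ->
  'N[mu]_+oo[EFin \o f] <= M%:E.
Proof.
move=> mf M0 fM; rewrite unlock; case: ifPn => _; last by rewrite lee_fin.
apply/ess_supP.
have negl n : {ae mu, forall x, (`|f x| < M + n.+1%:R^-1)%R}.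
  exists (superlevel f (M + n.+1%:R^-1)); split.
  - exact: measurable_superlevel.
  - by apply: fM; rewrite ltrDl invr_gt0.
  - by move=> x /= /negP; rewrite -leNgt.
have : {ae mu, forall x n, (`|f x| < M + n.+1%:R^-1)%R} by exact/ae_foralln.
apply: filterS => x Hx; rewrite /= lee_fin; apply/ler_addgt0Pr => e e0.
apply: ltW; apply: lt_le_trans (Hx (Num.trunc e^-1)) _; rewrite lerD2l.
by rewrite invf_ple ?posrE//; apply/ltW; exact: truncnS_gt.
Qed.

Lemma superlevel_Lnorm_infty f M t : measurable_fun setT f ->
    'N[mu]_+oo[EFin \o f] <= M%:E -> (M < t)%R ->
  mu (superlevel f t) = 0.
Proof.
move=> mf; rewrite unlock; case: ifPn => [_ /ess_supP fM Mt|+ _ _].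
  have mS := measurable_superlevel f t mf.
  have : mu.-negligible (~` [set x | ~ superlevel f t x]).
    apply: filterS fM => x /=; rewrite lee_fin => fxM; apply/negP.
    by rewrite -ltNge (le_lt_trans fxM).
  by rewrite setCK => /(negligibleP _ mS).
rewrite -leNgt => muT0; apply/eqP; rewrite eq_le measure_ge0 andbT.
apply: le_trans muT0; apply: le_measure; rewrite ?inE//; exact: measurable_superlevel.
Qed.

Lemma superlevel_ae_eq0 f t : measurable_fun setT f -> (0 < t)%R ->
  EFin \o f = \0 %[ae mu] -> mu (superlevel f t) = 0.
Proof.
move=> mf t0 f0; have mS := measurable_superlevel f t mf.
have : mu.-negligible (~` [set x | ~ superlevel f t x]).
  apply: filterS f0 => x /(_ Logic.I) /= [fx0].
  by rewrite /superlevel/= fx0 normr0 => /le_gtF; rewrite t0.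
by rewrite setCK => /(negligibleP _ mS).
Qed.

Lemma Lnorm_superlevel0 f (r : \bar R) : measurable_fun setT f -> 0 < r ->
    (forall t, (0 < t)%R -> mu (superlevel f t) = 0) ->
  'N[mu]_r[EFin \o f] = 0.
Proof.
move=> mf r0 f0; apply/eqP; rewrite eq_le Lnorm_ge0 andbT.
case: r r0 => [r r0| _|//]; last exact: Lnorm_infty_le.
rewrite lte_fin in r0.
have : \int[mu]_x (`|f x| `^ r)%:E <= (2 `^ r * 0)%:E.
  apply: integral_le_dyadic_bound => // [t t0|t n t0]; first by rewrite f0.
  rewrite big1// => i _; rewrite /level_mass f0 ?mulr0//.
  by rewrite mulr_gt0 ?exprn_gt0.
rewrite mulr0 => H.
have := @poweR_Lnorm _ _ _ mu (EFin \o f) r; rewrite gt_eqF// => /(_ isT) E.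
have {}E : 'N[mu]_r%:E[EFin \o f] `^ r = 0.
  by apply/eqP; rewrite eq_le poweR_ge0 andbT E.
by rewrite (poweR_eq0_eq0 (Lnorm_ge0 _ _ _) E).
Qed.

Lemma Lnorm_le_dyadic f r D : measurable_fun setT f -> (0 < r)%R ->
    (forall t, (0 < t)%R -> mu (superlevel f t) < +oo) ->
    dyadic_bound r D (level_mass mu f) ->
  'N[mu]_r%:E[EFin \o f] <= (2 * D `^ r^-1)%:E.
Proof.
move=> mf r0 ffin bD.
have D0 : (0 <= D)%R by have := bD 1%R 0%N ltr01; rewrite big_ord0.
have := integral_le_dyadic_bound mu f r D mf r0 ffin bD.
have -> : \int[mu]_x (`|f x| `^ r)%:E = 'N[mu]_r%:E[EFin \o f] `^ r.
  by rewrite poweR_Lnorm ?gt_eqF.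
move=> H.
have -> : 'N[mu]_r%:E[EFin \o f] = ('N[mu]_r%:E[EFin \o f] `^ r) `^ r^-1.
  by rewrite -poweRrM mulfV ?gt_eqF// poweRe1 ?Lnorm_ge0.
have -> : (2 * D `^ r^-1)%:E = (2 `^ r * D)%:E `^ r^-1.
  rewrite poweR_EFin powRM ?powR_ge0// -powRrM mulfV ?gt_eqF// powRr1//.
by apply: gt0_ler_poweR; rewrite ?in_itv/= ?leey ?andbT ?invr_ge0 ?poweR_ge0 ?lee_fin ?mulr_ge0 ?powR_ge0 ?(ltW r0).
Qed.

Lemma Lnorm_le_interpolation p g r s th C0 : (1 <= p)%R -> (0 < g)%R ->
    (0 < r)%R -> (0 < s)%R -> (0 < th)%R -> (th <= 1)%R -> (0 < C0)%R ->
    r^-1%R = (th * (1 - g) / p + (1 - th) / s)%R ->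
  exists2 C, (0 < C)%R & forall f A, measurable_fun setT f -> (0 < A)%R ->
    \int[mu]_x (`|f x| `^ p)%:E < +oo ->
    band_bound p g (C0 * A `^ p) (level_mass mu f) ->
    0 < 'N[mu]_s%:E[EFin \o f] < +oo ->
    'N[mu]_r%:E[EFin \o f] <= C%:E * A%:E `^ th * 'N[mu]_s%:E[EFin \o f] `^ (1 - th).
Proof.
move=> p1 g0 r0 s0 th0 th1 C00 rE.
have p0 : (0 < p)%R by exact: lt_le_trans p1.
pose cs q : R := (2 `^ q / (2 `^ q - 1))%R.
have cs0 q : (0 < q)%R -> (0 < cs q)%R.
  by move=> q0; rewrite divr_gt0 ?powR_gt0// powR2_sub1_gt0.
have [C1 C10 HC1] := dyadic_interpolation p g r s th p1 g0 r0 s0 th0 th1 rE.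
exists (2 * (C1 `^ r^-1 * C0 `^ (th / p) * cs s `^ ((1 - th) / s)))%R.
  by rewrite !mulr_gt0 ?powR_gt0 ?cs0.
move=> f A mf A0 fp bK /andP[Ns0 Nsoo].
have ffin t : (0 < t)%R -> mu (superlevel f t) < +oo.
  by move=> t0; exact: superlevel_lty mf t0 p0 fp.
have fsE : \int[mu]_x (`|f x| `^ s)%:E = 'N[mu]_s%:E[EFin \o f] `^ s.
  by rewrite poweR_Lnorm ?gt_eqF.
have fs : \int[mu]_x (`|f x| `^ s)%:E < +oo by rewrite fsE poweR_lty.
have bP := dyadic_bound_level_mass mu f p mf p0 fp.
have bS := dyadic_bound_level_mass mu f s mf s0 fs.
have Nsfin : 'N[mu]_s%:E[EFin \o f] \is a fin_num by rewrite ge0_fin_numE ?Lnorm_ge0.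
move: Ns0 fsE bS; rewrite -(fineK Nsfin) => Ns0 fsE.
move: Ns0 fsE; set n := fine _; rewrite lte_fin => n0 ->; rewrite poweR_EFin/= => bS.
rewrite -/(cs s) in bS.
have K0 : (0 < C0 * A `^ p)%R by rewrite mulr_gt0 ?powR_gt0.
have S0 : (0 < cs s * n `^ s)%R by rewrite mulr_gt0 ?powR_gt0 ?cs0.
have bD := HC1 (level_mass mu f) _ _ _ K0 S0 (level_mass_ge0 mu f)
  (fun x y => level_mass_le mu f x y mf ffin) bP bK bS.
apply: le_trans (Lnorm_le_dyadic f r _ mf r0 ffin bD) _.
rewrite -!EFinM lee_fin le_eqVlt; apply/orP; left; apply/eqP.
have := cs0 s s0; move: (cs s) => c c0.
rewrite !powRM ?mulr_ge0 ?powR_ge0 ?(ltW C10) ?(ltW C00) ?(ltW c0)//.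
rewrite -!powRrM.
have -> : (th * r / p * r^-1 = th / p)%R by field; rewrite !gt_eqF.
have -> : ((1 - th) * r / s * r^-1 = (1 - th) / s)%R by field; rewrite !gt_eqF.
have -> : (p * (th / p) = th)%R by field; rewrite !gt_eqF.
have -> : (s * ((1 - th) / s) = 1 - th)%R by field; rewrite !gt_eqF.
by ring.
Qed.

(** As [|f|] does not exceed its essential supremum, the exponent [r] follows from
    the smaller exponent [th * r], for which the weight of the interpolation is 1;
    the second exponent can then be any one with a finite moment, such as [p]. *)
Lemma Lnorm_le_interpolation_infty p g r th C0 : (1 <= p)%R -> (0 < g)%R ->
    (0 < r)%R -> (0 < th)%R -> (th <= 1)%R -> (0 < C0)%R ->
    r^-1%R = (th * (1 - g) / p)%R ->
  exists2 C, (0 < C)%R & forall f A, measurable_fun setT f -> (0 < A)%R ->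
    \int[mu]_x (`|f x| `^ p)%:E < +oo ->
    band_bound p g (C0 * A `^ p) (level_mass mu f) ->
    0 < 'N[mu]_+oo[EFin \o f] < +oo ->
    'N[mu]_r%:E[EFin \o f] <= C%:E * A%:E `^ th * 'N[mu]_+oo[EFin \o f] `^ (1 - th).
Proof.
move=> p1 g0 r0 th0 th1 C00 rE.
have p0 : (0 < p)%R by exact: lt_le_trans p1.
have q0 : (0 < th * r)%R by rewrite mulr_gt0.
have qE : ((th * r)^-1 = 1 * (1 - g) / p + (1 - 1) / p)%R.
  rewrite invfM rE; field; by rewrite !gt_eqF.
have [C1 C10 HC1] := dyadic_interpolation p g (th * r) p 1 p1 g0 q0 p0 ltr01 (lexx _) qE.
exists (2 * (C1 `^ r^-1 * C0 `^ (th / p)))%R; first by rewrite !mulr_gt0 ?powR_gt0.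
move=> f A mf A0 fp bK /andP[M0 Moo].
have ffin t : (0 < t)%R -> mu (superlevel f t) < +oo.
  by move=> t0; exact: superlevel_lty mf t0 p0 fp.
have bP := dyadic_bound_level_mass mu f p mf p0 fp.
have Mfin : 'N[mu]_+oo[EFin \o f] \is a fin_num by rewrite ge0_fin_numE ?Lnorm_ge0.
have fM t : (fine 'N[mu]_+oo[EFin \o f] < t)%R -> level_mass mu f t = 0%R.
  move=> Mt; rewrite /level_mass (superlevel_Lnorm_infty f _ t mf _ Mt)//.
  by rewrite fineK.
move: M0 fM; rewrite -(fineK Mfin); set M := fine _; rewrite lte_fin => M0 fM.
have K0 : (0 < C0 * A `^ p)%R by rewrite mulr_gt0 ?powR_gt0.
set S := (_ * fine _)%R in bP.
have S0 : (0 < Num.max S 1%R)%R by rewrite lt_max ltr01 orbT.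
have bS : dyadic_bound p (Num.max S 1%R) (level_mass mu f).
  by move=> t n t0; apply: le_trans (bP t n t0) _; rewrite le_max lexx.
have bq := HC1 (level_mass mu f) _ _ _ K0 S0 (level_mass_ge0 mu f)
  (fun x y => level_mass_le mu f x y mf ffin) bP bK bS.
have qr : (th * r <= r)%R by rewrite ger_pMl.
have bD := dyadic_bound_cutoff (level_mass mu f) M (th * r)%R r _ (ltW M0) qr
  (level_mass_ge0 mu f) fM bq.
apply: le_trans (Lnorm_le_dyadic f r _ mf r0 ffin bD) _.
rewrite poweR_EFin -!EFinM lee_fin le_eqVlt; apply/orP; left; apply/eqP.
rewrite subrr !mul0r powRr0 mulr1 mul1r.
rewrite !powRM ?mulr_ge0 ?powR_ge0 ?(ltW C10) ?(ltW C00) ?(ltW M0)//.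
rewrite -!powRrM.
have -> : ((r - th * r) * r^-1 = 1 - th)%R by field; rewrite !gt_eqF.
have -> : (th * r / p * r^-1 = th / p)%R by field; rewrite !gt_eqF.
have -> : (p * (th / p) = th)%R by field; rewrite !gt_eqF.
by ring.
Qed.

Lemma Lnorm_infty_le_band11 C0 : (0 < C0)%R ->
  exists2 C, (0 < C)%R & forall f A, measurable_fun setT f -> (0 < A)%R ->
    \int[mu]_x (`|f x| `^ 1)%:E < +oo ->
    band_bound 1 1 (C0 * A `^ 1) (level_mass mu f) ->
    'N[mu]_+oo[EFin \o f] <= (C * A)%:E.
Proof.
move=> C00; exists (2 * C0)%R; first by rewrite mulr_gt0.
move=> f A mf A0 fp bK.
have ffin t : (0 < t)%R -> mu (superlevel f t) < +oo.
  by move=> t0; exact: superlevel_lty mf t0 ltr01 fp.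
rewrite powRr1 ?(ltW A0)// in bK.
apply: Lnorm_infty_le => //; first by rewrite !mulr_ge0 ?(ltW C00) ?(ltW A0).
move=> t tM; have t0 : (0 < t)%R.
  by apply: le_lt_trans tM; rewrite !mulr_ge0 ?(ltW C00) ?(ltW A0).
apply/eqP; rewrite eq_le measure_ge0 andbT leNgt; apply/negP => St.
have Nt : (0 < level_mass mu f t)%R by rewrite fine_gt0// St ffin.
have := @band_bound11_support _ (C0 * A)%R (level_mass mu f) (mulr_gt0 C00 A0)
  (level_mass_ge0 mu f) (fun x y => level_mass_le mu f x y mf ffin) bK t t0 Nt.
by rewrite leNgt mulrA tM.
Qed.

Lemma Lnorm_infty_le_interpolation p g s th C0 : (1 <= p)%R -> (1 < g)%R ->
    (0 < s)%R -> (0 < th)%R -> (0 < C0)%R ->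
    0%R = (th * (1 - g) / p + (1 - th) / s)%R ->
  exists2 C, (0 < C)%R & forall f A, measurable_fun setT f -> (0 < A)%R ->
    \int[mu]_x (`|f x| `^ p)%:E < +oo ->
    band_bound p g (C0 * A `^ p) (level_mass mu f) ->
    0 < 'N[mu]_s%:E[EFin \o f] < +oo ->
    'N[mu]_+oo[EFin \o f] <= C%:E * A%:E `^ th * 'N[mu]_s%:E[EFin \o f] `^ (1 - th).
Proof.
move=> p1 g1 s0 th0 C00 thE.
have p0 : (0 < p)%R by exact: lt_le_trans p1.
have [C1 C10 HC1] := band_bound_support p g s th p0 g1 s0 th0 thE.
exists (C1 * C0 `^ (th / p))%R; first by rewrite mulr_gt0 ?powR_gt0.
move=> f A mf A0 fp bK /andP[Ns0 Nsoo].
have ffin t : (0 < t)%R -> mu (superlevel f t) < +oo.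
  by move=> t0; exact: superlevel_lty mf t0 p0 fp.
have fsE : \int[mu]_x (`|f x| `^ s)%:E = 'N[mu]_s%:E[EFin \o f] `^ s.
  by rewrite poweR_Lnorm ?gt_eqF.
have Nsfin : 'N[mu]_s%:E[EFin \o f] \is a fin_num by rewrite ge0_fin_numE ?Lnorm_ge0.
move: Ns0 fsE; rewrite -(fineK Nsfin); set n := fine _; rewrite lte_fin => n0 fsE.
have K0 : (0 < C0 * A `^ p)%R by rewrite mulr_gt0 ?powR_gt0.
have S0 : (0 < n `^ s)%R by rewrite powR_gt0.
have bS t : (0 < t)%R -> (t `^ s * level_mass mu f t <= n `^ s)%R.
  move=> t0; rewrite -lee_fin EFinM /level_mass fineK ?ge0_fin_numE ?ffin//.
  by rewrite -[X in _ <= X]fsE; exact: chebyshev_superlevel.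
rewrite poweR_EFin -!EFinM.
have C2A : (0 <= C1 * C0 `^ (th / p) * A `^ th * n `^ (1 - th))%R.
  by rewrite !mulr_ge0 ?powR_ge0// ltW.
apply: Lnorm_infty_le => // t tM; have t0 : (0 < t)%R by exact: le_lt_trans tM.
apply/eqP; rewrite eq_le measure_ge0 andbT leNgt; apply/negP => St.
have Nt : (0 < level_mass mu f t)%R by rewrite fine_gt0// St ffin.
have := HC1 (level_mass mu f) _ _ K0 S0 (level_mass_ge0 mu f)
  (fun x y => level_mass_le mu f x y mf ffin) bK bS t t0 Nt.
rewrite leNgt => /negP; apply; apply: le_lt_trans tM.
rewrite le_eqVlt; apply/orP; left; apply/eqP.
rewrite powRM ?powR_ge0 ?(ltW C00)// -!powRrM.
have -> : (p * (th / p) = th)%R by field; rewrite !gt_eqF.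
have -> : (s * ((1 - th) / s) = 1 - th)%R by field; rewrite !gt_eqF.
by ring.
Qed.

End NormsFromDecay.

(** * The interpolation inequality *)

Lemma sobolev_exponentV (R : realType) (p Q a : R) : (0 < p)%R -> (0 < Q)%R ->
  (sobolev_exponent p Q a)^-1 = ((1 - a * p / Q) / p)%:E.
Proof.
move=> p0 Q0; rewrite /sobolev_exponent; case: eqVneq => [QE|Qn].
  by rewrite invey -QE divff ?gt_eqF// subrr mul0r.
have Qa : (Q - a * p)%R != 0%R by rewrite subr_eq0.
rewrite inver mulf_eq0 invr_eq0 (negbTE Qa) orbF mulf_eq0 !gt_eqF//=.
by congr EFin; field; rewrite Qa !gt_eqF.
Qed.

(** A vanishing factor on the right means that [f = 0] almost everywhere, and an
    infinite one makes the right-hand side infinite, except when it is the norm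
    of exponent [s] with power [1 - th = 0]. *)
Lemma Lnorm_interpolation_reduction d (T : measurableType d) (R : realType)
    (mu : {measure set T -> \bar R}) (f : T -> R) (r s A C : \bar R) (th : R) :
    measurable_fun setT f -> 0 < r -> 0 < s -> (0 < th)%R -> 0 < C ->
    0 <= A ->
    (A = 0 -> forall t, (0 < t)%R -> mu (superlevel f t) = 0) ->
    (forall a : R, A = a%:E -> (0 < a)%R -> 0 < 'N[mu]_s[EFin \o f] ->
       'N[mu]_s[EFin \o f] < +oo \/ th = 1%R ->
       'N[mu]_r[EFin \o f] <= C * A `^ th * 'N[mu]_s[EFin \o f] `^ (1 - th)) ->
  'N[mu]_r[EFin \o f] <= C * A `^ th * 'N[mu]_s[EFin \o f] `^ (1 - th).
Proof.
move=> mf r0 s0 th0 C0 A0 A00 H.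
have RHS0 : 0 <= C * A `^ th * 'N[mu]_s[EFin \o f] `^ (1 - th).
  by rewrite !mule_ge0 ?poweR_ge0// ltW.
have zero : (forall t, (0 < t)%R -> mu (superlevel f t) = 0) ->
    'N[mu]_r[EFin \o f] <= C * A `^ th * 'N[mu]_s[EFin \o f] `^ (1 - th).
  by move=> f0; rewrite Lnorm_superlevel0.
have [/A00/zero//|An] := eqVneq A 0.
have {A00}A0' : 0 < A by rewrite lt_def An.
have [Ns|Ns] := eqVneq ('N[mu]_s[EFin \o f]) 0.
  apply: zero => t t0; apply: superlevel_ae_eq0 => //.
  by apply: Lnorm_eq0_eq0 Ns => //; exact/measurable_EFinP.
have {}Ns : 0 < 'N[mu]_s[EFin \o f] by rewrite lt_def Ns Lnorm_ge0.
have CA : 0 < C * A `^ th by rewrite mule_gt0// poweR_gt0.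
case: A A0' {zero RHS0 An A0} H CA => [a a0 H _|_ _ _|//]; last first.
  by rewrite poweRyr ?gt_eqF// gt0_muley// gt0_mulye ?leey// poweR_gt0.
have [Nsoo|] := eqVneq ('N[mu]_s[EFin \o f]) +oo; last first.
  by rewrite -ltey => Nsoo; apply: (H a) => //; left.
have [th1|th1] := eqVneq th 1%R; first by apply: (H a) => //; right.
rewrite Nsoo poweRyr; last by rewrite subr_eq0 eq_sym.
by rewrite gt0_muley ?leey// mule_gt0// lte_fin powR_gt0.
Qed.

Theorem theorem4p5 (R : realType) (X : pmetricType R)
    (mu : {measure set (borel_type X) -> \bar R})
    (card_X : exists x y : X, x <> y)
    (mu_regular : borel_regular mu)
    (mu_doubling : positive_doubling mu)
    (Q : R) (Q_gt0 : (0 < Q)%R) (mu_growth : volume_growth mu Q)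
    (p alpha : R) (p_ge1 : (1 <= p)%R) (alpha_gt0 : (0 < alpha)%R)
    (mu_noncollapsed : exists2 R0 : R, (0 < R0)%R &
      0 < ereal_inf [set mu (ball x R0) | x in [set: X]])
    (P_p_alpha : property_P mu p alpha)
    (r s : \bar R) (theta : R) (r_gt0 : 0 < r) (s_gt0 : 0 < s)
    (theta_gt0 : (0 < theta)%R) (theta_le1 : (theta <= 1)%R)
    (r_eq : r^-1 = theta%:E * (sobolev_exponent p Q alpha)^-1
                   + (1 - theta)%:E * s^-1)
    (r_fin : Q = (alpha * p)%R -> (1 < p)%R -> r < +oo) :
  exists2 C : R, (0 < C)%R &
    forall f : borel_type X -> R, KS_space mu p alpha f ->
      'N[mu]_r[EFin \o f] <=
        C%:E * ('N[mu]_(p%:E)[EFin \o f] + p_variation mu p f) `^ theta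
             * 'N[mu]_s[EFin \o f] `^ (1 - theta).
Proof.
have p0 : (0 < p)%R by exact: lt_le_trans p_ge1.
have [C0 C00 HB] := band_bound_level_mass mu p alpha Q p_ge1 alpha_gt0 Q_gt0
  mu_doubling mu_growth mu_noncollapsed P_p_alpha.
set g := (alpha * p / Q)%R in HB.
have g0 : (0 < g)%R by rewrite divr_gt0 ?mulr_gt0.
suff [C Cgt0 HC] : exists2 C : R, (0 < C)%R &
    forall (f : borel_type X -> R) (A : R), measurable_fun setT f -> (0 < A)%R -> \int[mu]_x (`|f x| `^ p)%:E < +oo ->
    0 < 'N[mu]_(p%:E)[EFin \o f] < +oo ->
    band_bound p g (C0 * A `^ p) (level_mass mu f) ->
    0 < 'N[mu]_s[EFin \o f] -> 'N[mu]_s[EFin \o f] < +oo \/ theta = 1%R ->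
    'N[mu]_r[EFin \o f] <= C%:E * A%:E `^ theta * 'N[mu]_s[EFin \o f] `^ (1 - theta).
  exists C => // f fKS.
  have [/(Lfun_pE mu p f p0)[mf fp] _] := fKS.
  have V0 : 0 <= p_variation mu p f.
    by apply: limf_einf_ge0 => t; exact: poweR_ge0.
  have N0 : 0 <= 'N[mu]_p%:E[EFin \o f] by exact: Lnorm_ge0.
  have Np0 : 'N[mu]_p%:E[EFin \o f] = 0 ->
      forall t, (0 < t)%R -> mu (superlevel f t) = 0.
    move=> Np t t0; apply: superlevel_ae_eq0 => //.
    by apply: Lnorm_eq0_eq0 Np => //; exact/measurable_EFinP.
  apply: Lnorm_interpolation_reduction => //.
  - by rewrite adde_ge0.
  - by move=> /eqP; rewrite padde_eq0// => /andP[/eqP /Np0].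
  - move=> a aE a0 Ns Ns'; rewrite aE; apply: HC => //.
      apply/andP; split; last first.
        by apply: (@le_lt_trans _ _ a%:E); [rewrite -aE leeDl|rewrite ltry].
      rewrite lt_def N0 andbT; apply/eqP => /Np0 f0.
      by move: Ns; rewrite (Lnorm_superlevel0 mu f s mf s_gt0 f0) ltxx.
    by apply: HB => //; [exact: ltW|rewrite aE].
rewrite sobolev_exponentV// -/g in r_eq.
case: r r_gt0 r_eq r_fin => [r|_|//].
- rewrite lte_fin => r0; rewrite inver gt_eqF// => rE _.
  (* the norm of exponent s, possibly infinite, appears with power 0: the finite
     exponent p can replace it *)
  have [th1|thn1] := eqVneq theta 1%R.
    have rE' : r^-1%R = (theta * (1 - g) / p + (1 - theta) / p)%R.
      by move: rE; rewrite th1 subrr !mul0e mul0r adde0 addr0 mul1e => -[->]; rewrite mul1r.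
    have [C Cgt0 HC] := Lnorm_le_interpolation mu p g r p theta C0 p_ge1 g0 r0 p0
      theta_gt0 theta_le1 C00 rE'.
    exists C => // f A mf A0 fp Np bK Ns _.
    by have := HC f A mf A0 fp bK Np; rewrite th1 subrr !poweRe0.
  case: s s_gt0 rE => [s|_|//].
    rewrite lte_fin => s0; rewrite inver gt_eqF// -!EFinM -EFinD mulrA => -[rE].
    have [C Cgt0 HC] := Lnorm_le_interpolation mu p g r s theta C0 p_ge1 g0 r0 s0
      theta_gt0 theta_le1 C00 rE.
    exists C => // f A mf A0 fp Np bK Ns [Nsoo|/eqP]; last by rewrite (negbTE thn1).
    by apply: HC => //; rewrite Ns.
  rewrite invey mule0 adde0 -EFinM mulrA => -[rE].
  have [C Cgt0 HC] := Lnorm_le_interpolation_infty mu p g r theta C0 p_ge1 g0 r0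
    theta_gt0 theta_le1 C00 rE.
  exists C => // f A mf A0 fp Np bK Ns [Nsoo|/eqP]; last by rewrite (negbTE thn1).
  by apply: HC => //; rewrite Ns.
(* for r infinite, r_eq forces g >= 1, with equality exactly when theta = 1 or s is
   infinite *)
rewrite invey => rE r_fin.
have [|] := pselect (theta = 1%R \/ s = +oo).
  move=> th1_or_s.
  have tg : (theta * ((1 - g) / p) = 0)%R.
    case: th1_or_s rE => [->|->]; last by rewrite invey mule0 adde0 -EFinM => -[].
    by rewrite subrr mul0e adde0 -EFinM => -[].
  have g1 : g = 1%R.
    move/eqP: tg; rewrite !mulf_eq0 invr_eq0 (gt_eqF p0) (gt_eqF theta_gt0) orbF subr_eq0.
    by move/eqP.
  have QE : Q = (alpha * p)%R.
    by rewrite -[LHS]mul1r -g1 /g divfK ?gt_eqF.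
  have p1 : p = 1%R.
    apply/eqP; rewrite eq_le p_ge1 andbT leNgt; apply/negP => /(r_fin QE).
    by rewrite ltxx.
  have [C Cgt0 HC] := Lnorm_infty_le_band11 mu C0 C00.
  (* for s infinite, the bound C * A is used for the factor of power theta of the
     supremum norm only *)
  exists (C `^ theta)%R; first by rewrite powR_gt0.
  move=> f A mf A0 fp Np; rewrite g1 p1 in fp * => bK Ns Ns'.
  have CA := HC f A mf A0 fp bK.
  rewrite -poweR_EFin -poweRM ?lee_fin ?(ltW Cgt0) ?(ltW A0)// -EFinM.
  case: th1_or_s => [th1|sE].
    by rewrite th1 subrr poweRe0 mule1 poweRe1// lee_fin mulr_ge0 ?(ltW Cgt0) ?(ltW A0).
  rewrite sE in Ns *.
  have th1 : (theta + (1 - theta) = 1)%R by rewrite addrC subrK.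
  rewrite -[X in X <= _]poweRe1 ?Lnorm_ge0// -{1}th1 poweRD; last first.
    by apply: nneg_neq0_poweRD_def; rewrite ?gt_eqF ?subr_ge0 ?(ltW theta_gt0).
  rewrite lee_wpmul2r ?poweR_ge0//; apply: gt0_ler_poweR;
    by rewrite ?in_itv/= ?leey ?andbT ?Lnorm_ge0 ?lee_fin ?mulr_ge0 ?(ltW theta_gt0) ?(ltW Cgt0) ?(ltW A0).
move=> /not_orP[thn1 sn]; case: s s_gt0 sn {HB} rE => [s|//|//].
rewrite lte_fin => s0 _; rewrite inver gt_eqF// -!EFinM -EFinD mulrA => -[rE].
have g1 : (1 < g)%R.
  have th1 : (0 < 1 - theta)%R by rewrite subr_gt0 lt_neqAle theta_le1 andbT; exact/eqP.
  rewrite ltNge; apply/negP => g1.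
  have : (0 < theta * (1 - g) / p + (1 - theta) / s)%R.
    by rewrite ltr_wpDl ?divr_gt0// divr_ge0 ?mulr_ge0 ?subr_ge0 ?(ltW theta_gt0) ?(ltW p0).
  by rewrite -rE ltxx.
have [C Cgt0 HC] := Lnorm_infty_le_interpolation mu p g s theta C0 p_ge1 g1 s0
  theta_gt0 C00 rE.
exists C => // f A mf A0 fp Np bK Ns [Nsoo|//].
by apply: HC => //; rewrite Ns.
Qed.
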